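(* Let $R$ be a commutative ring with $1$, let $a,b\in R$, let $(W,S)$ be a finite Coxeter system, let $I,J\subseteq S$, and let $M$ be a left $H_I$-module. Then there is an isomorphism of left $H_J$-modules $$ M \big\uparrow^{H_S}_{H_I} \big\downarrow^{H_S}_{H_J} \;\cong\; \bigoplus_{\tau \in {}^{J}W^{I}} c_{\tau}\Big[M \big\downarrow^{H_I}_{H_{\tau^{-1} K(\tau) \tau}}\Big]\, \Big\uparrow^{H_J}_{H_{K(\tau)}}, $$ where $c_{\tau}: H_{K(\tau)} \rightarrow H_{\tau^{-1} K(\tau) \tau}$ is the $R$-algebra homomorphism determined by $\pi_k \mapsto \pi_{\tau^{-1} k \tau}$ for $k\in K(\tau)$.
   Context: Two variable Hecke algebra: for a finite Coxeter system $(W,S)$ with Coxeter matrix $(m_{st})_{s,t\in S}$, $H_W(a,b)$ is the associative unital $R$-algebra generated by $\pi_s$ ($s\in S$) subject to $\pi_s^2=a\pi_s+b$ for $s\in S$ and the braid relations $\pi_s\pi_t\pi_s\cdots=\pi_t\pi_s\pi_t\cdots$ ($m_{st}$ factors on each side) for all $s\neq t$ in $S$. For a reduced expression $w=s_{i_1}\cdots s_{i_l}$ one sets $\pi_w=\pi_{s_{i_1}}\cdots\pi_{s_{i_l}}$ (independent of the reduced expression); the $\pi_w$, $w\in W$, form an $R$-basis of $H_W(a,b)$. Parabolic subalgebras: for $I\subseteq S$, $W_I$ is the subgroup of $W$ generated by $I$, and $H_I:=H_{W_I}(a,b)$ is the subalgebra of $H_S:=H_W(a,b)$ generated by $\pi_s$,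 $s\in I$. Double cosets: ${}^{J}W^{I}$ is the set of the (unique) minimal length representatives of the double cosets in $W_J\backslash W/W_I$. For $w\in W$, $K(w):=J\cap (wIw^{-1})$ and $w^{-1}K(w)w=(w^{-1}Jw)\cap I$. Induction and restriction: for a subalgebra $B\subseteq A$ and a left $B$-module $N$, $N\uparrow^A_B:=A\otimes_B N$; for a left $A$-module $L$, $L\downarrow^A_B$ is $L$ regarded as a $B$-module. Twist: for an algebra homomorphism $\mu:B\to A$ and a left $A$-module $N$, $\mu[N]$ is the left $B$-module with the same underlying module as $N$ and action $b\cdot^{\mu} v:=\mu(b)\cdot v$. *)

(* Defs.v *)
From HB Require Import structures.
From mathcomp Require Import all_boot all_fingroup all_algebra.
From mathcomp Require Import boolp.

Set Implicit Arguments.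
Unset Strict Implicit.
Unset Printing Implicit Defensive.

Import GRing.Theory.

Local Open Scope ring_scope.
Local Open Scope quotient_scope.

Inductive fterm (R X : Type) :=
  | FVar of X
  | FCst of R
  | FAdd of fterm R X & fterm R X
  | FMul of fterm R X & fterm R X.
Arguments FVar {R X}.
Arguments FCst {R X}.

HB.instance Definition _ (R X : Type) := gen_eqMixin (fterm R X).
HB.instance Definition _ (R X : Type) := gen_choiceMixin (fterm R X).

Section PresentedAlgebra.
Context {R : comPzRingType} {X : Type}.
Variable E : fterm R X -> fterm R X -> Prop.

(* The least congruence containing E whose quotient is an R-algebra. *)
Inductive falg_eq : fterm R X -> fterm R X -> Prop :=
  | falg_rel x y : E x y -> falg_eq x y
  | falg_refl x : falg_eq x x
  | falg_sym x y : falg_eq x y -> falg_eq y x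
  | falg_trans x y z : falg_eq x y -> falg_eq y z -> falg_eq x z
  | falg_congD x x' y y' :
      falg_eq x x' -> falg_eq y y' -> falg_eq (FAdd x y) (FAdd x' y')
  | falg_congM x x' y y' :
      falg_eq x x' -> falg_eq y y' -> falg_eq (FMul x y) (FMul x' y')
  | falg_addA x y z : falg_eq (FAdd x (FAdd y z)) (FAdd (FAdd x y) z)
  | falg_addC x y : falg_eq (FAdd x y) (FAdd y x)
  | falg_add0 x : falg_eq (FAdd (FCst 0) x) x
  | falg_mulA x y z : falg_eq (FMul x (FMul y z)) (FMul (FMul x y) z)
  | falg_mulDl x y z :
      falg_eq (FMul (FAdd x y) z) (FAdd (FMul x z) (FMul y z))
  | falg_mulDr x y z :
      falg_eq (FMul x (FAdd y z)) (FAdd (FMul x y) (FMul x z))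
  | falg_mul0 x : falg_eq (FMul (FCst 0) x) (FCst 0)
  | falg_mul1 x : falg_eq (FMul (FCst 1) x) x
  | falg_cstD r s : falg_eq (FCst (r + s)) (FAdd (FCst r) (FCst s))
  | falg_cstM r s : falg_eq (FCst (r * s)) (FMul (FCst r) (FCst s))
  | falg_cstC r x : falg_eq (FMul (FCst r) x) (FMul x (FCst r)).

Definition falg_eqb (x y : fterm R X) : bool := `[< falg_eq x y >].

Lemma falg_eqb_refl : reflexive falg_eqb.
Proof. by move=> x; apply/asboolP/falg_refl. Qed.
Lemma falg_eqb_sym : symmetric falg_eqb.
Proof. by move=> x y; apply/asboolP/asboolP => /falg_sym. Qed.
Lemma falg_eqb_trans : transitive falg_eqb.
Proof.
by move=> y x z /asboolP xy /asboolP yz; apply/asboolP/(falg_trans xy).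
Qed.

Canonical falg_equiv :=
  EquivRel falg_eqb falg_eqb_refl falg_eqb_sym falg_eqb_trans.

Definition presalg := {eq_quot falg_eqb}.
HB.instance Definition _ := Choice.on presalg.
HB.instance Definition _ := EqQuotient.on presalg.

Lemma presalgP (x y : fterm R X) :
  falg_eq x y <-> \pi_presalg x = \pi_presalg y.
Proof.
split=> [xy|/eqP]; first by apply/eqP; rewrite piE; apply/asboolP.
by rewrite piE => /asboolP.
Qed.

Lemma repr_presalg x : falg_eq (generic_quotient.repr (\pi_presalg x)) x.
Proof. by apply/presalgP; rewrite reprK. Qed.

Definition presalg_cst (r : R) : presalg := \pi_presalg (FCst r).
Definition presalg_add := lift_op2 presalg (@FAdd R X).
Definition presalg_mul := lift_op2 presalg (@FMul R X).
Definition presalg_scale (r : R) : presalg -> presalg :=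
  presalg_mul (presalg_cst r).
Definition presalg_opp : presalg -> presalg := presalg_scale (- 1).

Lemma pi_presalg_add x y :
  presalg_add (\pi_presalg x) (\pi_presalg y) = \pi_presalg (FAdd x y).
Proof.
by unlock presalg_add; apply/presalgP/falg_congD; apply: repr_presalg.
Qed.

Lemma pi_presalg_mul x y :
  presalg_mul (\pi_presalg x) (\pi_presalg y) = \pi_presalg (FMul x y).
Proof.
by unlock presalg_mul; apply/presalgP/falg_congM; apply: repr_presalg.
Qed.

Let piD := pi_presalg_add.
Let piM := pi_presalg_mul.
Let pic r : presalg_cst r = \pi_presalg (FCst r). Proof. by []. Qed.

Fact presalg_addA : associative presalg_add.
Proof.
elim/quotW=> x; elim/quotW=> y; elim/quotW=> z; rewrite !piD.
apply/presalgP; exact: falg_addA.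
Qed.
Fact presalg_addC : commutative presalg_add.
Proof.
by elim/quotW=> x; elim/quotW=> y; rewrite !piD;
   apply/presalgP; exact: falg_addC.
Qed.
Fact presalg_add0 : left_id (presalg_cst 0) presalg_add.
Proof.
by elim/quotW=> x; rewrite pic piD; apply/presalgP; exact: falg_add0.
Qed.
Fact presalg_mulA : associative presalg_mul.
Proof.
elim/quotW=> x; elim/quotW=> y; elim/quotW=> z; rewrite !piM.
apply/presalgP; exact: falg_mulA.
Qed.
Fact presalg_mulDl : left_distributive presalg_mul presalg_add.
Proof.
elim/quotW=> x; elim/quotW=> y; elim/quotW=> z; rewrite !(piD, piM).
apply/presalgP; exact: falg_mulDl.
Qed.
Fact presalg_mulDr : right_distributive presalg_mul presalg_add.
Proof.
elim/quotW=> x; elim/quotW=> y; elim/quotW=> z; rewrite !(piD, piM).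
apply/presalgP; exact: falg_mulDr.
Qed.
Fact presalg_mul0 : left_zero (presalg_cst 0) presalg_mul.
Proof.
by elim/quotW=> x; rewrite pic piM; apply/presalgP; exact: falg_mul0.
Qed.
Fact presalg_mul1 : left_id (presalg_cst 1) presalg_mul.
Proof.
by elim/quotW=> x; rewrite pic piM; apply/presalgP; exact: falg_mul1.
Qed.
Fact presalg_cstC r x :
  presalg_mul (presalg_cst r) x = presalg_mul x (presalg_cst r).
Proof.
by elim/quotW: x => x; rewrite pic !piM; apply/presalgP; exact: falg_cstC.
Qed.
Fact presalg_mul1r : right_id (presalg_cst 1) presalg_mul.
Proof. by move=> x; rewrite -presalg_cstC presalg_mul1. Qed.
Fact presalg_cstD r s :
  presalg_cst (r + s) = presalg_add (presalg_cst r) (presalg_cst s).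
Proof. by rewrite !pic piD; apply/presalgP; exact: falg_cstD. Qed.
Fact presalg_cstM r s :
  presalg_cst (r * s) = presalg_mul (presalg_cst r) (presalg_cst s).
Proof. by rewrite !pic piM; apply/presalgP; exact: falg_cstM. Qed.
Fact presalg_addN : left_inverse (presalg_cst 0) presalg_opp presalg_add.
Proof.
move=> x; rewrite /presalg_opp /presalg_scale.
by rewrite -{2}[x]presalg_mul1 -presalg_mulDl -presalg_cstD addNr presalg_mul0.
Qed.

HB.instance Definition _ := GRing.isZmodule.Build presalg
  presalg_addA presalg_addC presalg_add0 presalg_addN.
HB.instance Definition _ := GRing.Zmodule_isPzRing.Build presalg
  presalg_mulA presalg_mul1 presalg_mul1r presalg_mulDl presalg_mulDr.

Fact presalg_scaleA r s (x : presalg) :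
  presalg_scale r (presalg_scale s x) = presalg_scale (r * s) x.
Proof. by rewrite /presalg_scale presalg_mulA presalg_cstM. Qed.
Fact presalg_scale1 : left_id 1 presalg_scale.
Proof. exact: presalg_mul1. Qed.
Fact presalg_scaleDr : right_distributive presalg_scale +%R.
Proof. by move=> r x y; apply: presalg_mulDr. Qed.
Fact presalg_scaleDl (x : presalg) :
  {morph presalg_scale^~ x : r s / r + s}.
Proof. by move=> r s; rewrite /presalg_scale presalg_cstD presalg_mulDl. Qed.

HB.instance Definition _ := GRing.Zmodule_isLmodule.Build R presalg
  presalg_scaleA presalg_scale1 presalg_scaleDr presalg_scaleDl.

Definition presalg_var (x : X) : presalg := \pi_presalg (FVar x).

End PresentedAlgebra.

(* The Coxeter matrix is m_st = #[s * t]; the last clause states that the     *)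
(* relations (s t)^m_st = 1, s, t in S, present W (s = t gives s^2 = 1).      *)
Definition coxeter_system (W : finGroupType) (S : {set W}) : Prop :=
  [/\ <<S>>%g = [set: W],
      {in S, forall s, #[s]%g = 2%N} &
      forall (G : groupType) (f : W -> G),
        {in S &, forall s t, ((f s * f t) ^+ #[s * t] = 1)%g} ->
        exists phi : {multiplicative W -> G}, {in S, phi =1 f}].

Section Hecke.
Context {R : comPzRingType} (a b : R) {W : finGroupType} (S : {set W}).

(* x y x y ... with n factors *)
Fixpoint alternating {X : Type} (x y : fterm R X) (n : nat) : fterm R X :=
  if n is n'.+1 then FMul x (alternating y x n') else FCst 1.

Inductive hecke_rel :
    fterm R {s : W | s \in S} -> fterm R {s : W | s \in S} -> Prop :=
  | hecke_quadratic s :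
      hecke_rel (FMul (FVar s) (FVar s))
                (FAdd (FMul (FCst a) (FVar s)) (FCst b))
  | hecke_braid s t : s != t ->
      hecke_rel (alternating (FVar s) (FVar t) #[val s * val t]%g)
                (alternating (FVar t) (FVar s) #[val s * val t]%g).

Definition hecke := presalg hecke_rel.
HB.instance Definition _ := GRing.PzRing.on hecke.
HB.instance Definition _ := GRing.Lmodule.on hecke.

(* hgen s is only meaningful for s in S. *)
Definition hgen (s : W) : hecke :=
  if insub s is Some u then presalg_var hecke_rel u else 0.

Definition subalgebra (P : {pred hecke}) : Prop :=
  [/\ 1 \in P, GRing.linear_closed P & GRing.mulr_2closed P].

Section Parabolic.
Variable I : {set W}.

Definition hecke_par_pred : {pred hecke} := fun x =>
  `[< forall P : {pred hecke},
        subalgebra P -> {in I, forall s, hgen s \in P} -> x \in P >].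

Lemma hecke_par_subalgebra : subalgebra hecke_par_pred.
Proof.
split.
- by apply/asboolP => P [].
- move=> r x y /asboolP xI /asboolP yI; apply/asboolP => P sP gP.
  by case: (sP) => _ linP _; apply: linP; [apply: xI | apply: yI].
- move=> x y /asboolP xI /asboolP yI; apply/asboolP => P sP gP.
  by case: (sP) => _ _ mulP; apply: mulP; [apply: xI | apply: yI].
Qed.

Lemma hecke_par_submod : GRing.subsemimod_closed hecke_par_pred.
Proof.
have [one lin _] := hecke_par_subalgebra.
have zero : 0 \in hecke_par_pred.
  by rewrite -(subrr (1 : hecke)) addrC -scaleN1r lin.
split; first by split=> // x y xI yI; rewrite -[x]scale1r lin.
by move=> r x xI; rewrite -[_ *: _]addr0 lin.
Qed.

Lemma hecke_par_semiring : GRing.mulr_closed hecke_par_pred.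
Proof. by case: hecke_par_subalgebra. Qed.

HB.instance Definition _ :=
  GRing.isSubmodClosed.Build R hecke hecke_par_pred hecke_par_submod.
HB.instance Definition _ :=
  GRing.isMulClosed.Build hecke hecke_par_pred hecke_par_semiring.

Definition hecke_par := {x : hecke | x \in hecke_par_pred}.
HB.instance Definition _ := SubChoice.on hecke_par.
HB.instance Definition _ := [SubChoice_isSubZmodule of hecke_par by <:].
HB.instance Definition _ := GRing.SubZmodule_isSubPzRing.Build
  hecke hecke_par_pred hecke_par (GRing.subringClosedP _).
HB.instance Definition _ := [SubZmodule_isSubLmodule of hecke_par by <:].

Lemma hgen_par s : s \in I -> hgen s \in hecke_par_pred.
Proof. by move=> sI; apply/asboolP => P _; apply. Qed.

Definition pgen s (sI : s \in I) : hecke_par := Sub (hgen s) (hgen_par sI).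

End Parabolic.

Lemma hecke_par_predS (K I : {set W}) : K \subset I ->
  {subset hecke_par_pred K <= hecke_par_pred I}.
Proof.
move=> /subsetP sKI x /asboolP xK; apply/asboolP => P sP gP.
by apply: xK => // s /sKI /gP.
Qed.

Section Inclusion.
Variables (K I : {set W}) (sKI : K \subset I).

Definition par_incl (x : hecke_par K) : hecke_par I :=
  Sub (val x) (hecke_par_predS sKI (valP x)).

Fact par_incl_zmod : zmod_morphism par_incl.
Proof. by move=> x y; apply: val_inj; rewrite [RHS]raddfB; apply: raddfB. Qed.
Fact par_incl_monoid : monoid_morphism par_incl.
Proof. by split=> [|x y]; apply: val_inj. Qed.

HB.instance Definition _ :=
  GRing.isZmodMorphism.Build (hecke_par K) (hecke_par I) par_incl
    par_incl_zmod.
HB.instance Definition _ :=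
  GRing.isMonoidMorphism.Build (hecke_par K) (hecke_par I) par_incl
    par_incl_monoid.
End Inclusion.

End Hecke.

Section DoubleCosets.
Context {W : finGroupType} (S J I : {set W}).

(* S ^+ n is the set of products of n elements of S. The default value is     *)
(* only taken outside the subgroup generated by S.                            *)
Definition clen (w : W) : nat :=
  if pselect (exists n, w \in (S ^+ n)%g) is left ex then ex_minn ex else 0%N.

Definition min_dcoset_reps : {set W} :=
  [set w | [forall v in (<<J>> :* w * <<I>>)%g, (clen w <= clen v)%N]].

(* In MathComp, A :^ x is x^-1 A x. *)
Definition dcosetK (w : W) : {set W} := J :&: (I :^ w^-1)%g.

Lemma dcosetK_subl w : dcosetK w \subset J.
Proof. exact: subsetIl. Qed.

Lemma dcosetK_conj_sub w : (dcosetK w :^ w)%g \subset I.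
Proof. by rewrite sub_conjg subsetIr. Qed.

End DoubleCosets.

(* When mu is the inclusion of a subalgebra, twist mu N is the restriction of *)
(* N to this subalgebra.                                                      *)
Definition twist {B A : pzRingType} (mu : {rmorphism B -> A})
  (N : lmodType A) : Type := N.

Section Twist.
Context {B A : pzRingType} (mu : {rmorphism B -> A}) (N : lmodType A).
HB.instance Definition _ := GRing.Zmodule.on (twist mu N).

Definition twist_scale (x : B) (v : twist mu N) : twist mu N :=
  mu x *: (v : N).

Fact twist_scaleA x y v :
  twist_scale x (twist_scale y v) = twist_scale (x * y) v.
Proof. by rewrite /twist_scale rmorphM scalerA. Qed.
Fact twist_scale1 : left_id 1 twist_scale.
Proof. by move=> v; rewrite /twist_scale rmorph1 scale1r. Qed.
Fact twist_scaleDr : right_distributive twist_scale +%R.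
Proof. by move=> x u v; apply: scalerDr. Qed.
Fact twist_scaleDl v : {morph twist_scale^~ v : x y / x + y}.
Proof. by move=> x y; rewrite /twist_scale rmorphD scalerDl. Qed.

HB.instance Definition _ := GRing.Zmodule_isLmodule.Build B (twist mu N)
  twist_scaleA twist_scale1 twist_scaleDr twist_scaleDl.
End Twist.

Inductive tterm (A N : Type) :=
  | TZero
  | TPure of A & N
  | TOpp of tterm A N
  | TAdd of tterm A N & tterm A N.
Arguments TZero {A N}.

HB.instance Definition _ (A N : Type) := gen_eqMixin (tterm A N).
HB.instance Definition _ (A N : Type) := gen_choiceMixin (tterm A N).

Section Induced.
Context {B A : pzRingType} (i : {rmorphism B -> A}) (N : lmodType B).

(* The abelian group generated by the x (x) n subject to biadditivity and     *)
(* x i(b) (x) n = x (x) b n.                                                  *)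
Inductive tensor_eq : tterm A N -> tterm A N -> Prop :=
  | tensor_refl x : tensor_eq x x
  | tensor_sym x y : tensor_eq x y -> tensor_eq y x
  | tensor_trans x y z : tensor_eq x y -> tensor_eq y z -> tensor_eq x z
  | tensor_congN x x' : tensor_eq x x' -> tensor_eq (TOpp x) (TOpp x')
  | tensor_congD x x' y y' :
      tensor_eq x x' -> tensor_eq y y' -> tensor_eq (TAdd x y) (TAdd x' y')
  | tensor_addA x y z : tensor_eq (TAdd x (TAdd y z)) (TAdd (TAdd x y) z)
  | tensor_addC x y : tensor_eq (TAdd x y) (TAdd y x)
  | tensor_add0 x : tensor_eq (TAdd TZero x) x
  | tensor_addN x : tensor_eq (TAdd (TOpp x) x) TZero
  | tensor_Dl x y n :
      tensor_eq (TPure (x + y) n) (TAdd (TPure x n) (TPure y n))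
  | tensor_Dr x m n :
      tensor_eq (TPure x (m + n)) (TAdd (TPure x m) (TPure x n))
  | tensor_balanced x b n :
      tensor_eq (TPure (x * i b) n) (TPure x (b *: n)).

Definition tensor_eqb (x y : tterm A N) : bool := `[< tensor_eq x y >].

Lemma tensor_eqb_refl : reflexive tensor_eqb.
Proof. by move=> x; apply/asboolP/tensor_refl. Qed.
Lemma tensor_eqb_sym : symmetric tensor_eqb.
Proof. by move=> x y; apply/asboolP/asboolP => /tensor_sym. Qed.
Lemma tensor_eqb_trans : transitive tensor_eqb.
Proof.
by move=> y x z /asboolP xy /asboolP yz; apply/asboolP/(tensor_trans xy).
Qed.

Canonical tensor_equiv :=
  EquivRel tensor_eqb tensor_eqb_refl tensor_eqb_sym tensor_eqb_trans.

Definition induced := {eq_quot tensor_eqb}.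
HB.instance Definition _ := Choice.on induced.
HB.instance Definition _ := EqQuotient.on induced.

Lemma inducedP (x y : tterm A N) :
  tensor_eq x y <-> \pi_induced x = \pi_induced y.
Proof.
split=> [xy|/eqP]; first by apply/eqP; rewrite piE; apply/asboolP.
by rewrite piE => /asboolP.
Qed.

Lemma repr_induced x : tensor_eq (generic_quotient.repr (\pi_induced x)) x.
Proof. by apply/inducedP; rewrite reprK. Qed.

Fixpoint tterm_act (z : A) (x : tterm A N) : tterm A N :=
  match x with
  | TZero => TZero
  | TPure y n => TPure (z * y) n
  | TOpp y => TOpp (tterm_act z y)
  | TAdd y y' => TAdd (tterm_act z y) (tterm_act z y')
  end.

Definition induced_zero : induced := \pi_induced TZero.
Definition induced_opp := lift_op1 induced (@TOpp A N).
Definition induced_add := lift_op2 induced (@TAdd A N).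
Definition induced_scale (z : A) := lift_op1 induced (tterm_act z).

Lemma pi_induced_opp x : induced_opp (\pi_induced x) = \pi_induced (TOpp x).
Proof. by unlock induced_opp; apply/inducedP/tensor_congN/repr_induced. Qed.
Lemma pi_induced_add x y :
  induced_add (\pi_induced x) (\pi_induced y) = \pi_induced (TAdd x y).
Proof.
by unlock induced_add; apply/inducedP/tensor_congD; apply: repr_induced.
Qed.

Lemma tterm_act_eq z x y :
  tensor_eq x y -> tensor_eq (tterm_act z x) (tterm_act z y).
Proof.
elim=> {x y} /=; try by constructor.
- by move=> x y z' _ xy _; apply: tensor_trans.
- by move=> x y n; rewrite mulrDr; constructor.
- by move=> x b n; rewrite mulrA; constructor.
Qed.

Lemma pi_induced_scale z x :
  induced_scale z (\pi_induced x) = \pi_induced (tterm_act z x).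
Proof.
by unlock induced_scale; apply/inducedP/tterm_act_eq/repr_induced.
Qed.

Let piN := pi_induced_opp.
Let piD := pi_induced_add.
Let piZ := pi_induced_scale.

Fact induced_addA : associative induced_add.
Proof.
elim/quotW=> x; elim/quotW=> y; elim/quotW=> z; rewrite !piD.
apply/inducedP; exact: tensor_addA.
Qed.
Fact induced_addC : commutative induced_add.
Proof.
by elim/quotW=> x; elim/quotW=> y; rewrite !piD;
   apply/inducedP; exact: tensor_addC.
Qed.
Fact induced_add0 : left_id induced_zero induced_add.
Proof. by elim/quotW=> x; rewrite piD; apply/inducedP; exact: tensor_add0. Qed.
Fact induced_addN : left_inverse induced_zero induced_opp induced_add.
Proof.
by elim/quotW=> x; rewrite piN piD; apply/inducedP; exact: tensor_addN.
Qed.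

HB.instance Definition _ := GRing.isZmodule.Build induced
  induced_addA induced_addC induced_add0 induced_addN.

Fact induced_scaleA y z (x : induced) :
  induced_scale y (induced_scale z x) = induced_scale (y * z) x.
Proof.
elim/quotW: x => x; rewrite !piZ; congr (\pi_induced _).
by elim: x => [|x n|x IHx|x IHx x' IHx'] //=;
   rewrite ?mulrA ?IHx ?IHx'.
Qed.
Fact induced_scale1 : left_id 1 induced_scale.
Proof.
elim/quotW=> x; rewrite piZ; congr (\pi_induced _).
by elim: x => [|x n|x IHx|x IHx x' IHx'] //=;
   rewrite ?mul1r ?IHx ?IHx'.
Qed.
Fact induced_scaleDr : right_distributive induced_scale +%R.
Proof.
move=> z; elim/quotW=> x; elim/quotW=> y.
by rewrite [_ + _]pi_induced_add [RHS]/GRing.add /= !piZ piD.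
Qed.
Fact induced_scaleDl (x : induced) :
  {morph induced_scale^~ x : y z / y + z}.
Proof.
have piDr u v : \pi_induced (TAdd u v) = \pi_induced u + \pi_induced v.
  by rewrite -[LHS]piD.
have piNr u : \pi_induced (TOpp u) = - \pi_induced u by rewrite -[LHS]piN.
have pi0 : \pi_induced TZero = 0 by [].
move=> y z; elim/quotW: x => x; rewrite !piZ.
elim: x => [|x n|x IHx|x IHx x' IHx'] /=.
- by rewrite pi0 addr0.
- by rewrite mulrDl -piDr; apply/inducedP; exact: tensor_Dl.
- by rewrite !piNr IHx opprD.
- by rewrite !piDr IHx IHx' addrACA.
Qed.

HB.instance Definition _ := GRing.Zmodule_isLmodule.Build A induced
  induced_scaleA induced_scale1 induced_scaleDr induced_scaleDl.

End Induced.

(* The index set is finite, so the direct sum is the product. *)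
Definition dsum {A : pzRingType} {T : finType} (N : T -> lmodType A) : Type :=
  forall t, N t.

Section DirectSum.
Context {A : pzRingType} {T : finType} (N : T -> lmodType A).

HB.instance Definition _ := gen_eqMixin (dsum N).
HB.instance Definition _ := gen_choiceMixin (dsum N).

Let ext (u v : dsum N) : (forall t, u t = v t) -> u = v.
Proof. exact: functional_extensionality_dep. Qed.

Definition dsum_zero : dsum N := fun=> 0.
Definition dsum_opp (u : dsum N) : dsum N := fun t => - u t.
Definition dsum_add (u v : dsum N) : dsum N := fun t => u t + v t.
Definition dsum_scale (x : A) (u : dsum N) : dsum N := fun t => x *: u t.

Fact dsum_addA : associative dsum_add.
Proof. by move=> u v w; apply: ext => t; apply: addrA. Qed.
Fact dsum_addC : commutative dsum_add.
Proof. by move=> u v; apply: ext => t; apply: addrC. Qed.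
Fact dsum_add0 : left_id dsum_zero dsum_add.
Proof. by move=> u; apply: ext => t; apply: add0r. Qed.
Fact dsum_addN : left_inverse dsum_zero dsum_opp dsum_add.
Proof. by move=> u; apply: ext => t; apply: addNr. Qed.

HB.instance Definition _ := GRing.isZmodule.Build (dsum N)
  dsum_addA dsum_addC dsum_add0 dsum_addN.

Fact dsum_scaleA x y u : dsum_scale x (dsum_scale y u) = dsum_scale (x * y) u.
Proof. by apply: ext => t; apply: scalerA. Qed.
Fact dsum_scale1 : left_id 1 dsum_scale.
Proof. by move=> u; apply: ext => t; apply: scale1r. Qed.
Fact dsum_scaleDr : right_distributive dsum_scale +%R.
Proof. by move=> x u v; apply: ext => t; apply: scalerDr. Qed.
Fact dsum_scaleDl u : {morph dsum_scale^~ u : x y / x + y}.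
Proof. by move=> x y; apply: ext => t; apply: scalerDl. Qed.

HB.instance Definition _ := GRing.Zmodule_isLmodule.Build A (dsum N)
  dsum_scaleA dsum_scale1 dsum_scaleDr dsum_scaleDl.
End DirectSum.

Definition lmod_iso {A : pzRingType} (U V : lmodType A) : Prop :=
  exists f : {linear U -> V}, bijective f.

(* Main.v *)
From HB Require Import structures.
Require Import Defs.
From mathcomp Require Import all_boot all_fingroup all_algebra all_solvable.
From mathcomp Require Import ring.

(** Let pi_w be the product of generators along a reduced word of w, and write
    W^I for the set of the shortest elements of the cosets w <<I>>. The pi_w
    form a basis of H, and pi_(d v) = pi_d pi_v for d in W^I and v in <<I>>.
    Hence H is a free right module over its subalgebra H_I, with basis the pi_d
    for d in W^I, and every element of H (x) M, the tensor product over H_I, is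
    uniquely a sum of pi_d (x) m_d. In the same way the summand at a double
    coset representative t consists of the sums of pi_u (x) m_u, where u runs
    through the elements of <<J>> that are shortest in u <<K(t)>>.

    The isomorphism sends x (x) m, in the summand at t, to x pi_t (x) m. It is
    well defined because pi_k pi_t = pi_t pi_(k ^ t) for k in K(t), both sides
    being pi_(k t). It sends pi_u (x) m to pi_(u t) (x) m, so it is bijective
    once each d in W^I is shown to be u t for exactly one pair (t, u); this is
    [rmin_dcoset], [rmin_dcoset_ex] and [rmin_dcoset_inj].

    Two ingredients come from the presentations. The presentation of W yields
    the exchange property, through a sign attached to each pair of an element
    and a reflection ([parity_cocycle], [descM]); all facts on lengths, cosets
    and parabolic subgroups are deduced from it. The presentation of H yields
    the basis: the pi_w are independent of the reduced word ([hpi_desc]), hence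
    they span ([hcoordK]), and they are independent because H acts on the
    functions on W as it would act on combinations of the pi_w ([act_eq],
    [hcoord_hpi]). *)

Set Implicit Arguments.
Unset Strict Implicit.
Unset Printing Implicit Defensive.

Import GRing.Theory.

(** * Coxeter systems: lengths and descents *)
Section Coxeter.
Local Open Scope group_scope.

Context {W : finGroupType} (S : {set W}) (cS : coxeter_system S).

Lemma coxeter_gen : <<S>> = [set: W]. Proof. by case: cS. Qed.

Lemma invS s : s \in S -> s^-1 = s.
Proof.
case: cS => _ oS _ sS.
by apply/eqP; rewrite eq_invg_mul -expg2 -(oS s sS) expg_order.
Qed.

Lemma mulSS s : s \in S -> s * s = 1.
Proof. by move=> sS; rewrite -{2}(invS sS) mulgV. Qed.

Lemma mulSK s : s \in S -> cancel (mulg s) (mulg s).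
Proof. by move=> sS w; rewrite mulgA mulSS ?mul1g. Qed.

Lemma neqS1 s : s \in S -> s != 1.
Proof. by case: cS => _ oS _ sS; rewrite -order_gt1 oS. Qed.

Lemma mem_gen_exp (A : {set W}) w : w \in <<A>> -> exists n, w \in A ^+ n.
Proof.
have [m ->] := gen_expgs A; elim: m w => [|m IH] w.
  by move=> w1; exists 0%N.
rewrite expgS => /mulsgP[x y]; rewrite !inE => /orP[/eqP-> /IH[n yn] ->|xA].
  by exists n; rewrite mul1g.
by move=> /IH[n yn] ->; exists n.+1; rewrite expgS mem_mulg.
Qed.

Lemma mem_expS w : exists n, w \in S ^+ n.
Proof. by apply: mem_gen_exp; rewrite coxeter_gen inE. Qed.

Local Notation l := (clen S).

Lemma clenP w : w \in S ^+ (l w) /\ forall n, w \in S ^+ n -> (l w <= n)%N.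
Proof.
rewrite /clen; case: boolp.pselect => [ex|[]]; last exact: mem_expS.
by case: ex_minnP.
Qed.

Lemma clen_le w n : w \in S ^+ n -> (l w <= n)%N.
Proof. by have [_] := clenP w; apply. Qed.

Lemma clen1 : l 1 = 0%N.
Proof. by apply/eqP; rewrite -leqn0 clen_le ?set11. Qed.

Lemma clen_eq0 w : (l w == 0%N) = (w == 1).
Proof.
apply/eqP/eqP=> [l0|->]; last exact: clen1.
by have [] := clenP w; rewrite l0 => /set1P.
Qed.

Lemma clenMl s w : s \in S -> (l (s * w) <= (l w).+1)%N.
Proof. by move=> sS; apply: clen_le; rewrite expgS mem_mulg //;
  case: (clenP w). Qed.

Lemma clenM u v : (l (u * v) <= l u + l v)%N.
Proof.
have [ul _] := clenP u; have [vl _] := clenP v.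
by apply: clen_le; rewrite expgD mem_mulg.
Qed.

Lemma clen_ge s w : s \in S -> (l w <= (l (s * w)).+1)%N.
Proof. by move=> sS; rewrite -{1}(mulSK sS w) clenMl. Qed.

Lemma clen_split w : w != 1 -> exists2 s, s \in S & l w = (l (s * w)).+1.
Proof.
rewrite -clen_eq0; case: (clenP w); case E: (l w) => [//|n].
rewrite expgS => /mulsgP[s v sS vn wE] _ _; exists s => //.
have lv: (l (s * w) <= n)%N by rewrite wE mulSK // clen_le.
by apply/eqP; rewrite eqSS eqn_leq lv -ltnS -E clen_ge.
Qed.

Lemma clenV w : l w^-1 = l w.
Proof.
have le x : (l x^-1 <= l x)%N.
  have [xl _] := clenP x; apply: clen_le; move: (l x) xl => n.
  elim: n x => [|n IH] x; first by rewrite expg0 => /set1P->;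
    rewrite invg1 set11.
  rewrite {1}expgS => /mulsgP[s v sS vn ->]; rewrite invMg expgSr.
  by rewrite mem_mulg ?IH // invS.
by apply/eqP; rewrite eqn_leq le -{1}(invgK w) le.
Qed.

(** The second argument ranges over all reflections, so that the descents of a
    product can be expressed by conjugates ([descM]). *)
Definition desc w t := (l (t * w) < l w)%N.
Definition reflection t := [exists s in S, exists x, t == s ^ x].

Lemma refl_conj s x : s \in S -> reflection (s ^ x).
Proof. by move=> sS; apply/exists_inP; exists s => //; apply/existsP;
  exists x. Qed.

Lemma reflS s : s \in S -> reflection s.
Proof. by move=> sS; rewrite -(conjg1 s) refl_conj. Qed.

Lemma reflJ t x : reflection t -> reflection (t ^ x).
Proof. by case/exists_inP=> s sS /existsP[y /eqP->];
  rewrite -conjgM refl_conj. Qed.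

Lemma refl_mul t : reflection t -> t * t = 1.
Proof.
by case/exists_inP=> s sS /existsP[x /eqP->]; rewrite -conjMg mulSS // conj1g.
Qed.

Section Parity.

(** The generators act on W x bool: they conjugate the first component, and s
    toggles the second one at the point s only. By the presentation of W,
    whether a word toggles t an odd number of times depends only on the element
    of W that it spells. *)
Definition flip (s : W) (p : W * bool) := (p.1 ^ s, p.2 (+) (s == p.1)).
Lemma flip_inj s : injective (flip s).
Proof. by case=> t e [t' e'] [/conjg_inj<-] /addIb->. Qed.
Definition flip_perm s := perm (@flip_inj s).

(** Along (s t)^n the point x is toggled once for each j < 2n such that x = (s
    t)^j s. This condition on j has period n = #[s * t], so the number of
    toggles is even. *)
Lemma flip_braid s t : s \in S -> t \in S ->
  (flip_perm s * flip_perm t) ^+ #[s * t] = 1.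
Proof.
move=> sS tS; set n := #[s * t].
pose c k x := odd (\sum_(i < k) (x == ((s * t) ^+ i * s)%g)).
have E k x e : ((flip_perm s * flip_perm t) ^+ k) (x, e) =
     (x ^ ((s * t) ^+ k), e (+) c k.*2 x).
  elim: k => [|k IH].
    by rewrite !expg0 perm1 conjg1 /c big_ord0 addbF.
  rewrite expgSr permM IH permM !permE /flip /= -!conjgM -expgSr.
  congr (_, _); rewrite -!addbA; congr (e (+) _).
  rewrite doubleS {2}/c !big_ord_recr /= !oddD !oddb -/(c _ _) -addbA.
  have stV: (s * t)^-1 = t * s by rewrite invMg !invS.
  have sst j : s * (s * t) ^- j = (s * t) ^+ j * s.
    rewrite -expgVn stV; elim: j => [|j IHj];
      first by rewrite !expg0 mulg1 mul1g.
    by rewrite expgS expgS -!mulgA -IHj !mulgA.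
  have eqJ y z : (y == x ^ z) = (x == z * y * z^-1).
    by rewrite eq_sym -(inj_eq (@conjg_inj _ z^-1)) conjgK conjgE invgK mulgA.
  rewrite !eqJ -(mulgA _ s) sst mulgA -expgD addnn.
  by rewrite invMg invS // -!mulgA sst !mulgA -(mulgA _ s t) -expgSr -expgD
    addSn addnn.
apply/permP=> -[x e]; rewrite E expg_order conjg1 perm1; congr (_, _).
rewrite /c -addnn big_split_ord /= -[RHS]addbF; congr (_ (+) _).
rewrite oddD [X in _ (+) odd X](eq_bigr (fun i : 'I_n =>
  (x == ((s * t) ^+ i * s)%g) : nat)) ?addbb //.
by move=> i _ /=; rewrite expgD expg_order mul1g.
Qed.

Lemma parity_cocycle : exists eta : W -> W -> bool,
  (forall s t, s \in S -> eta s t = (s == t)) /\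
  (forall x y t, eta (x * y) t = eta x t (+) eta y (t ^ x)).
Proof.
have [_ _ /(_ _ flip_perm flip_braid)[phi phiS]] := cS.
pose eta w t := (phi w (t, false)).2.
have phiE (w : W) : forall (t : W) (e : bool), phi w (t, e) = (t ^ w,
  e (+) eta w t).
  have [n] := mem_expS w; elim: n w => [|n IH] w; last first.
    rewrite expgS => /mulsgP[s v sS vn ->] t e.
    by rewrite /eta gmulfM !permM (phiS _ sS) !permE /flip !IH /= ?conjgM
      ?addbA.
  move/set1P=> -> t e; have phi1 : phi 1 = 1.
    by apply: (mulgI (phi 1)); rewrite -gmulfM !mulg1.
  by rewrite /eta phi1 !perm1 /= conjg1 addbF.
exists eta; split=> [s t sS|x y t]; first by rewrite /eta phiS // permE.
by rewrite {1}/eta gmulfM permM !phiE /=.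
Qed.
End Parity.

(** If eta w t, then t is toggled by some letter of a reduced word of w, and
    multiplying by t deletes this letter. If not, then eta (t w) t because eta
    t t holds for every reflection t, and the first case applied to t w shows
    that w is shorter than t w. *)
Lemma desc_parity : exists eta : W -> W -> bool,
  [/\ forall s t, s \in S -> eta s t = (s == t),
      forall x y t, eta (x * y) t = eta x t (+) eta y (t ^ x) &
      forall w t, reflection t -> desc w t = eta w t].
Proof.
have [eta [etaS etaM]] := parity_cocycle; exists eta; split=> //.
have lt w t : eta w t -> desc w t.
  rewrite /desc; elim: {w}_.+1 {-2}w (ltnSn (l w)) t => // n IH w.
  have [->|/clen_split[s sS lw]] := eqVneq w 1 => [_ t|].
    by have := etaM 1 1 t; rewrite mulg1 conjg1 addbb => ->.
  rewrite ltnS => lwn t; rewrite -{1}(mulSK sS w) etaM etaS //.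
  have [<-|_ /= e] := eqVneq s t; first by rewrite lw.
  have := IH _ _ _ e; rewrite -lw => /(_ lwn) lt.
  rewrite lw -(leq_add2r 1) !addn1 in lt *.
  apply: leq_ltn_trans lt; have := clenMl (t ^ s * (s * w)) sS.
  by rewrite conjgE !mulgA mulgV mul1g -(mulgA t s) mulSS ?mulg1.
move=> w t rt; apply/idP/idP; last exact: lt.
apply: contraLR => e; rewrite /desc -leqNgt; apply/ltnW.
have [s sS /existsP[x /eqP tE]] := exists_inP rt.
have t1 := refl_mul rt.
have e1 y : eta 1 y = false by have := etaM 1 1 y; rewrite mulg1 conjg1 addbb.
have ett : eta t t.
  have tx : t ^ x^-1 = s by rewrite tE conjgK.
  have es : eta x^-1 t = eta x s.
    by have := etaM x^-1 x t; rewrite mulVg e1 tx; do 2!case: (eta _ _).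
  rewrite {1}tE conjgE !etaM es tx (etaS s) // eqxx conjgE mulKg.
  by case: (eta _ _).
have := lt (t * w) t; rewrite /desc mulgA t1 mul1g etaM; apply.
by rewrite ett conjgE mulKg (negPf e).
Qed.

(** This is the exchange property in a form that does not mention words: if t
    shortens x y, then t shortens x or its conjugate t ^ x shortens y. *)
Lemma descM x y t : reflection t ->
  desc (x * y) t = desc x t (+) desc y (t ^ x).
Proof. by have [eta [_ etaM etaE]] := desc_parity => rt;
  rewrite !etaE ?reflJ. Qed.

Lemma descS s t : s \in S -> reflection t -> desc s t = (s == t).
Proof. by have [eta [etaS _ etaE]] := desc_parity => sS rt;
  rewrite etaE ?etaS. Qed.

Lemma desc1 t : desc 1 t = false.
Proof. by rewrite /desc clen1. Qed.

Lemma clen_desc w s : s \in S -> desc w s -> l w = (l (s * w)).+1.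
Proof. by move=> sS lt; apply/eqP; rewrite eqn_leq clen_ge. Qed.

(** As s shortens s, exactly one of w and s w is shortened by s; in particular
    s w never has the length of w. *)
Lemma clen_asc w s : s \in S -> ~~ desc w s -> l (s * w) = (l w).+1.
Proof.
move=> sS; rewrite -[desc _ _]negbK => /negPn nd; apply/eqP;
  rewrite eqn_leq clenMl //=.
have := descM s w (reflS sS);
  rewrite (descS sS) ?reflS // eqxx conjgE mulKg (negPf nd).
by rewrite /desc mulSK.
Qed.

Lemma clenS s : s \in S -> l s = 1%N.
Proof. by move=> sS; rewrite -[s]mulg1 clen_asc ?desc1 // clen1. Qed.

Lemma clen1P w : l w = 1%N -> w \in S.
Proof.
have [->|/clen_split[s sS ->]] := eqVneq w 1; first by rewrite clen1.
move=> [/eqP]; rewrite clen_eq0 => /eqP/(congr1 (mulg s)).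
by rewrite mulSK // mulg1 => ->.
Qed.

Lemma reflection_lt t w : reflection t -> ~~ desc w t -> (l w < l (t * w))%N.
Proof.
move=> rt; have tt := refl_mul rt.
have t_neq1 : t != 1.
  by case/exists_inP: rt => s sS /existsP[x /eqP->]; rewrite conjg_eq1 neqS1.
have := descM t w rt; rewrite conjgE mulKg /desc tt clen1 lt0n clen_eq0 t_neq1.
by rewrite mulgA tt mul1g => ->.
Qed.

(** * Alternating words *)

Fixpoint alt (s t : W) n := if n is n'.+1 then s * alt t s n' else 1.

Lemma alt_gen s t n : alt s t n \in <<[set s; t]>>.
Proof.
elim: n s t => [|n IH] s t /=; first exact: group1.
have := IH t s; rewrite setUC; apply: groupM; exact: mem_gen (set21 s t).
Qed.

Lemma alt_quo s t n : s \in S -> t \in S ->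
  alt s t n * (alt t s n)^-1 = (s * t) ^+ n.
Proof.
elim: n s t => [|n IH] s t sS tS /=; first by rewrite invg1 mulg1.
rewrite invMg (invS tS) mulgA -(mulgA s) IH //.
elim: n {IH} => [|n IH]; first by rewrite !mulg1.
by rewrite expgS [RHS]expgS -IH !mulgA.
Qed.

Lemma alt_sym s t : s \in S -> t \in S ->
  alt s t #[s * t] = alt t s #[s * t].
Proof.
move=> sS tS; apply: (mulIg (alt t s #[s * t])^-1).
by rewrite alt_quo // expg_order mulgV.
Qed.

Lemma order_sym s t : s \in S -> t \in S -> #[s * t] = #[t * s].
Proof. by move=> sS tS; rewrite -orderV invMg !invS. Qed.

(** The reflections that shorten a word are obtained by conjugating each letter
    by the letters before it. *)
Lemma alt_desc s t n x : s \in S -> t \in S -> reflection x ->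
  desc (alt s t n) x -> exists2 i, (i < n)%N & x = (s * t) ^+ i * s.
Proof.
elim: n s t x => [|n IH] s t x sS tS rx /=; first by rewrite desc1.
rewrite descM // (descS sS) //; have [<-|_ d] := eqVneq s x.
  by exists 0%N; rewrite // mul1g.
have [i lt_in E] := IH t s (x ^ s) tS sS (reflJ s rx) d.
exists i.+1 => //; rewrite -(conjgK s x) E (invS sS) conjgE (invS sS).
have swap j : (t * s) ^+ j * t = t * (s * t) ^+ j.
  by elim: j => [|j IHj]; rewrite ?mulg1 ?mul1g // !expgS -!mulgA IHj.
by rewrite swap expgS !mulgA.
Qed.

(** If the alternating word failed to grow at some letter, then [alt_desc]
    would give (t s)^i = 1 for some i with 0 < i < #[s * t]. *)
Lemma clen_alt s t n : s \in S -> t \in S -> (n <= #[s * t])%N ->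
  l (alt s t n) = n.
Proof.
elim: n s t => [|n IH] s t sS tS /=; first by rewrite clen1.
rewrite (order_sym sS tS) => lt_n; have altn := IH t s tS sS (ltnW lt_n).
rewrite clen_asc ?altn //.
apply/negP => /(alt_desc tS sS (reflS sS))[i lt_in] E.
have : (t * s) ^+ i.+1 == 1 by rewrite expgSr mulgA -E mulSS.
by move/order_inf; rewrite leqNgt (leq_ltn_trans lt_in).
Qed.

(** * Parabolic subgroups *)

Section Parabolic.
Context (K : {set W}) (sKS : K \subset S).

Let KS s : s \in K -> s \in S. Proof. exact/subsetP. Qed.

(** The number n of letters taken in K is carried along, because the induction
    has to restart from a shorter word in K when the last letter s cancels the
    descent r of the other ones, that is when v s = r v. *)
Lemma parabolic_desc_word n u : u \in K ^+ n -> u != 1 ->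
  exists s m, [/\ s \in K, desc u s, (m < n)%N & s * u \in K ^+ m].
Proof.
elim: {n}n.+1 {-2}n (ltnSn n) u => // N IH [|n];
  first by move=> _ u /set1P-> /eqP[].
rewrite ltnS => nN u; rewrite expgSr => /mulsgP[v s vn sK ->] vs1.
have sS := KS sK.
have [v1|v_neq1] := eqVneq v 1.
  exists s, 0%N; rewrite v1 mul1g mulSS // set11; split=> //.
  by rewrite descS ?reflS.
have [r [m [rK dr mn rv]]] := IH n nN v vn v_neq1.
have rS := KS rK; have rrefl := reflS rS.
have := descM v s rrefl; rewrite dr (descS sS) ?reflJ //.
have [sE _|_ dvs] := eqVneq s (r ^ v); last first.
  by exists r, m.+1; rewrite dvs mulgA expgSr mem_mulg ?ltnS.
(* Here v s = r v is also spelled by a word of fewer than n letters. *)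
have vsE : v * s = r * v by rewrite sE conjgE mulKVg.
rewrite vsE in vs1 *.
have [r' [m' [r'K d lt' rv']]] := IH m (ltn_trans mn nN) _ rv vs1.
by exists r', m'; split=> //; exact: ltn_trans lt' (leqW mn).
Qed.

Lemma parabolic_desc u : u \in <<K>> -> u != 1 -> exists2 s, s \in K & desc u s.
Proof.
move=> /mem_gen_exp[n un] u1;
  have [s [m [sK d _ _]]] := parabolic_desc_word un u1.
by exists s.
Qed.

(** Induction along reduced words in the letters of K. *)
Lemma parabolic_ind (P : W -> Prop) : P 1 ->
    (forall s w, s \in K -> w \in <<K>> -> ~~ desc w s -> P w -> P (s * w)) ->
  forall w, w \in <<K>> -> P w.
Proof.
move=> P1 PM w; have [n] := ubnP (l w); elim: n w => // n IH w.
rewrite ltnS => lwn wK; have [->//|w1] := eqVneq w 1.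
have [s sK ds] := parabolic_desc wK w1; have sS := KS sK.
rewrite -(mulSK sS w); have swK := groupM (mem_gen sK) wK.
apply: PM => //; first by rewrite /desc mulSK // -leqNgt ltnW.
by apply: IH => //; apply: leq_trans ds lwn.
Qed.

Lemma desc_parabolic u t : u \in <<K>> -> reflection t -> desc u t ->
  t \in <<K>>.
Proof.
move=> uK; elim/parabolic_ind: u / uK t => [|s w sK wK _ IH] t rt.
  by rewrite desc1.
have sS := KS sK; rewrite descM // (descS sS) //.
have [<-|_ d] := eqVneq s t; first by rewrite mem_gen.
have tsK := IH _ (reflJ s rt) d.
by rewrite -(conjgK s t) groupJ // groupV mem_gen.
Qed.

Lemma parabolicI s : s \in S -> s \in <<K>> -> s \in K.
Proof.
move=> sS sK; have [r rK] := parabolic_desc sK (neqS1 sS).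
by rewrite descS ?(reflS (KS rK)) // => /eqP->.
Qed.

Definition lmin (w : W) := [forall s in K, ~~ desc w s].

Lemma lminP w : reflect (forall s, s \in K -> ~~ desc w s) (lmin w).
Proof. exact: forall_inP. Qed.

(** If s shortened w d but not w, then by [descM] the reflection s ^ w, which
    lies in <<K>>, would shorten d. *)
Lemma coset_min_mul d u : (forall v, v \in <<K>> -> l d <= l (v * d))%N ->
  u \in <<K>> -> l (u * d) = (l u + l d)%N.
Proof.
move=> dmin uK; elim/parabolic_ind: u / uK => [|s w sK wK nd IH].
  by rewrite mul1g clen1.
have sS := KS sK; have nd' : ~~ desc (w * d) s.
  rewrite descM ?reflS // (negPf nd) /= /desc -leqNgt dmin //.
  by rewrite groupJ // mem_gen.
by rewrite -mulgA !(clen_asc sS) // IH.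
Qed.

(** It suffices that d is the shortest element of <<K>> d. Let v0 d be the
    shortest one: lengths add up in d = v0^-1 (v0 d), so a descent of v0^-1 in
    K would also be a descent of d. *)
Lemma lmin_mul d u : lmin d -> u \in <<K>> -> l (u * d) = (l u + l d)%N.
Proof.
move=> /lminP dmin; apply: coset_min_mul => w wK.
have [v0 v0K v0min] := @arg_minnP _ 1 (fun v => v \in <<K>>) (fun v =>
  l (v * d)) (group1 _).
have add v : v \in <<K>> -> l (v * (v0 * d)) = (l v + l (v0 * d))%N.
  by apply: coset_min_mul => x xK; rewrite mulgA v0min ?groupM.
have v0V : v0^-1 \in <<K>> by rewrite groupV.
have [v01|v0_neq1] := eqVneq v0^-1 1.
  by have := v0min _ wK; move/eqP: v01; rewrite eq_invg1 => /eqP->;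
    rewrite mul1g.
have [s sK] := parabolic_desc v0V v0_neq1.
have := dmin s sK; rewrite /desc -{1 2}(mulKg v0 d) mulgA !add ?(groupM
  (mem_gen sK)) //.
by rewrite ltn_add2r => /negPf->.
Qed.

(** This is dual to [lmin_mul]: w is the longest element of <<K>> w. For K =
    {s, t} it splits off the longest element of a dihedral subgroup. *)
Lemma lmax_mul w v : (forall s, s \in K -> desc w s) -> v \in <<K>> ->
  l w = (l v + l (v * w))%N.
Proof.
move=> wmax.
have [v0 v0K v0max] := @arg_maxnP _ 1 (fun v => v \in <<K>>) (fun v =>
  l (v * w)) (group1 _).
have add u : u \in <<K>> -> l (v0 * w) = (l u + l (u * (v0 * w)))%N.
  move=> uK; elim/parabolic_ind: u / uK => [|s u sK uK nd ->].
    by rewrite clen1 mul1g.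
  have sS := KS sK; rewrite -mulgA (clen_asc sS nd) addSnnS -clen_desc //.
  rewrite descM ?reflS // (negPf nd) /=; apply: contraT.
  move/(reflection_lt (reflJ u (reflS sS))); rewrite mulgA ltnNge => /negP[].
  by apply: v0max; rewrite groupM // groupJ // mem_gen.
have v0V : v0^-1 \in <<K>> by rewrite groupV.
have [/eqP|v0_neq1] := eqVneq v0^-1 1.
  by rewrite eq_invg1 => /eqP v01; move: (add v); rewrite v01 mul1g.
have [s sK] := parabolic_desc v0V v0_neq1.
have := wmax s sK; rewrite /desc; have := add _ (groupM (mem_gen sK) v0V).
rewrite -mulgA mulKg (add _ v0V) mulKg => E lt1 lt2.
by have := leq_add lt2 (ltnW lt1); rewrite addSn -E ltnn.
Qed.

End Parabolic.
End Coxeter.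

(** * Minimal coset and double coset representatives *)
Section Cosets.
Local Open Scope group_scope.
Context {W : finGroupType} (S : {set W}) (cS : coxeter_system S).
Local Notation l := (clen S).

(** By [rmin_mul] these are the elements of W^K. *)
Definition rmin (K : {set W}) (w : W) := lmin S K w^-1.

Section OneSided.
Context (K : {set W}) (sKS : K \subset S).

Lemma rmin_mul d v : rmin K d -> v \in <<K>> -> l (d * v) = (l d + l v)%N.
Proof.
move=> dmin vK; rewrite -(clenV cS) invMg (lmin_mul cS sKS) ?groupV //.
by rewrite !(clenV cS) addnC.
Qed.

Lemma rmin_split w : exists d v, [/\ rmin K d, v \in <<K>> & w = d * v].
Proof.
have [v0 v0K v0min] := @arg_minnP _ 1 (fun v => v \in <<K>>) (fun v =>
  l (w * v)) (group1 _).
exists (w * v0), v0^-1; rewrite groupV mulgK; split=> //;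
  apply/forall_inP=> s sK.
rewrite /desc -leqNgt clenV // -(clenV cS (s * _)) invMg invgK -mulgA.
by apply: v0min; rewrite groupM // groupV mem_gen.
Qed.

(** The elements d and d' are both the shortest one of their common coset. *)
Lemma rmin_inj d d' v v' : rmin K d -> rmin K d' -> v \in <<K>> ->
  v' \in <<K>> ->
  d * v = d' * v' -> d = d' /\ v = v'.
Proof.
move=> dm dm' vK vK' E; suffices Ed : d = d' by split=> //; move: E;
  rewrite Ed => /mulgI.
have xK : v * v'^-1 \in <<K>> by rewrite groupM ?groupV.
have E' : d' = d * (v * v'^-1) by rewrite mulgA E mulgK.
have := rmin_mul dm xK; rewrite -E' => l1.
have := rmin_mul dm' (groupVr xK); rewrite {1}E' mulgK l1 -addnA -[LHS]addn0.
move/addnI/esym/eqP; rewrite addn_eq0 (clen_eq0 cS) => /andP[/eqP x1 _].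
by rewrite E' x1 mulg1.
Qed.

End OneSided.

Section Double.
Context (J I : {set W}) (sJS : J \subset S) (sIS : I \subset S).
Local Notation reps := (min_dcoset_reps S J I).
Local Notation K := (dcosetK J I).

Lemma dcoset_repP t : t \in reps ->
  forall u v, u \in <<J>> -> v \in <<I>> -> (l t <= l (u * t * v))%N.
Proof.
rewrite inE => /forall_inP tmin u v uJ vI; apply: tmin.
by rewrite !mem_mulg ?set11.
Qed.

Lemma dcoset_rep_lmin t : t \in reps -> lmin S J t.
Proof.
move/dcoset_repP=> tmin; apply/forall_inP=> s sJ;
  rewrite /desc -leqNgt -[s * t]mulg1.
by rewrite tmin ?group1 ?(mem_gen sJ).
Qed.

Lemma dcoset_rep_rmin t : t \in reps -> rmin I t.
Proof.
move/dcoset_repP=> tmin; apply/forall_inP=> s sI;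
  rewrite /desc -leqNgt clenV //.
rewrite -(clenV cS (s * _)) invMg invgK.
have := tmin 1 s^-1 (group1 _); rewrite mul1g; apply.
by rewrite groupV mem_gen.
Qed.

Lemma dcoset_rep_ex w : exists t u v,
  [/\ t \in reps, u \in <<J>>, v \in <<I>> & w = u * t * v].
Proof.
have wD : w \in <<J>> :* w * <<I>>.
  by rewrite -[w in w \in _]mulg1 mem_mulg ?rcoset_refl.
have [t tD tmin] := @arg_minnP _ w (fun x => x \in <<J>> :* w * <<I>>) l wD.
have [x v /rcosetP[u uJ ->] vI tE] := mulsgP tD.
exists t, u^-1, v^-1; rewrite !groupV; split=> //;
  last by rewrite tE mulgA !mulgK mulKg.
rewrite inE; apply/forall_inP=> y /mulsgP[z v' /rcosetP[u' uJ' ->] vI' ->].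
apply: tmin; apply/mulsgP; exists (u' * u * w) (v * v'); rewrite ?groupM //.
  by apply/rcosetP; exists (u' * u); rewrite ?groupM.
by rewrite tE !mulgA.
Qed.

(** If r in I shortened u t on the right, then x = t r t^-1 would shorten u^-1,
    and therefore lie in <<J>>. The two expressions x t = t r then give l x =
    1, so x belongs to J, hence to K(t), against the minimality of u. *)
Lemma rmin_dcoset t u : t \in reps -> u \in <<J>> -> rmin (K t) u ->
  rmin I (u * t).
Proof.
move=> tr uJ umin; apply/forall_inP=> r rI; have rS := subsetP sIS r rI.
have rr := reflS rS; rewrite invMg descM // (negPf (forall_inP
  (dcoset_rep_rmin tr) _ rI)) /=.
apply/negP=> d; set x := r ^ t^-1 in d.
have xJ' : x \in <<J>> by apply: (desc_parabolic cS sJS (groupVr uJ)) d;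
  apply: reflJ.
have xt : x * t = t * r by rewrite /x conjgE invgK !mulgA mulgKV.
have lx : l x = 1%N.
  apply/(@addIn (l t)); rewrite -(lmin_mul cS sJS (dcoset_rep_lmin tr) xJ') xt.
  by rewrite (rmin_mul sIS (dcoset_rep_rmin tr)) ?mem_gen // (clenS cS rS)
    addnC.
have xK : x \in K t.
  rewrite inE memJ_conjg rI andbT.
  exact: (parabolicI cS sJS (clen1P cS lx) xJ').
by move/negP: (forall_inP umin x xK); apply.
Qed.

Lemma dcosetK_J t : K t \subset S.
Proof. exact: subset_trans (dcosetK_subl J I t) sJS. Qed.

Lemma dcosetK_conj_gen t k : k \in <<K t>> -> k ^ t \in <<I>>.
Proof.
move=> kK; apply: (subsetP (genS (dcosetK_conj_sub J I t))).
by rewrite genJ memJ_conjg.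
Qed.

(** Write d = u0 t v0 and u0 = u k with k in <<K(t)>>. As k t = t (k ^ t) with
    k ^ t in <<I>>, the elements d and u t are both the shortest one of the
    same coset of <<I>>. *)
Lemma rmin_dcoset_ex d : rmin I d -> exists t u,
  [/\ t \in reps, u \in <<J>>, rmin (K t) u & d = u * t].
Proof.
move=> dmin; have [t [u0 [v0 [tr u0J v0I dE]]]] := dcoset_rep_ex d.
have [u [k [umin kK u0E]]] := rmin_split (K t) u0.
have kJ := subsetP (genS (dcosetK_subl J I t)) k kK.
have uJ : u \in <<J>> by rewrite -(groupMr _ kJ) -u0E.
exists t, u; split=> //.
have [] := rmin_inj sIS dmin (rmin_dcoset tr uJ umin) (group1 _)
   (groupM (dcosetK_conj_gen kK) v0I) _ => //.
by rewrite mulg1 dE u0E conjgE !mulgA mulgK.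
Qed.

(** Splitting u'^-1 u as u0 k with k in <<K(t)>>, the elements t' and u0 t are
    both the shortest one of the same coset of <<I>>, so they are equal. Since
    neither t nor t' is longer than the other, u0 = 1. *)
Lemma rmin_dcoset_inj t t' u u' : t \in reps -> t' \in reps ->
  u \in <<J>> -> u' \in <<J>> -> rmin (K t) u -> rmin (K t') u' ->
  u * t = u' * t' -> t = t' /\ u = u'.
Proof.
move=> tr tr' uJ uJ' um um' E; suffices Et : t = t' by split=> //;
  apply: (mulIg t'); rewrite -E Et.
have [u0 [k [u0min kK u0E]]] := rmin_split (K t) (u'^-1 * u).
have kJ := subsetP (genS (dcosetK_subl J I t)) k kK.
have u0J : u0 \in <<J>> by rewrite -(groupMr _ kJ) -u0E groupM ?groupV.
have [] := rmin_inj sIS (dcoset_rep_rmin tr') (rmin_dcoset tr u0J u0min)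
  (group1 _)
   (dcosetK_conj_gen kK) _.
  by rewrite mulg1 conjgE !mulgA mulgK -u0E -mulgA E mulKg.
move=> t'E _; have := dcoset_repP tr uJ (group1 _).
have le : (l t' <= l t)%N.
  have := dcoset_repP tr' (groupVr u0J) (group1 <<I>>%G).
  by rewrite {2}t'E mulg1 mulKg.
move: le; rewrite t'E (lmin_mul cS sJS (dcoset_rep_lmin tr) u0J) -{2}[l
  t]add0n leq_add2r leqn0.
by rewrite (clen_eq0 cS) => /eqP->; rewrite mul1g.
Qed.

End Double.
End Cosets.

(** * The regular representation of the Hecke algebra *)
Section RegularRepresentation.
Local Open Scope ring_scope.

Context {R : comPzRingType} (a b : R) {W : finGroupType} (S : {set W}).
Context (cS : coxeter_system S).
Local Notation H := (hecke a b S).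
Local Notation desc := (desc S).

Let funE (f g : W -> R) : (forall w, f w = g w) -> f = g.
Proof. exact: boolp.functional_extensionality_dep. Qed.

(** A function f stands for the combination of the pi_w with coefficients f w,
    and this is the effect on coefficients of left multiplication by pi_s: it
    sends pi_w to pi_(s w) if s w is longer than w, and to a pi_w + b pi_(s w)
    otherwise. *)
Definition lmulS (s : W) (f : W -> R) : W -> R := fun w =>
  if desc w s then f (s * w)%g + a * f w else b * f (s * w)%g.
(** The mirror image of [lmulS]: right multiplication by pi_s. *)
Definition rmulS (s : W) (f : W -> R) : W -> R := fun w =>
  if desc w^-1 s then f (w * s)%g + a * f w else b * f (w * s)%g.
Definition delta (u : W) : W -> R := fun w => (w == u)%:R.

Lemma descMs s w : s \in S -> desc (s * w)%g s = ~~ desc w s.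
Proof. by move=> sS; rewrite (descM cS) ?reflS // (descS cS) ?reflS // eqxx
  conjgE mulKg. Qed.

Lemma lmulS_quadratic s f : s \in S ->
  lmulS s (lmulS s f) = fun w => a * lmulS s f w + b * f w.
Proof.
move=> sS; apply: funE => w; rewrite /lmulS descMs // (mulSK cS sS).
by case: (desc w s) => /=; ring.
Qed.

(** By [descM], w and w t have the same behaviour under s unless t = s ^ w, and
    symmetrically for s w and w under t; so the operators commute at w by a
    formal computation. In the exceptional case s w = w t, and the two
    operators have the same values at w and at s w. *)
Lemma lmulS_rmulS s t f : s \in S -> t \in S ->
  lmulS s (rmulS t f) = rmulS t (lmulS s f).
Proof.
move=> sS tS; apply: funE => w; have rs := reflS sS; have rt := reflS tS.
have dl : desc (w * t)%g s = desc w s (+) (t == s ^ w)%g.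
  by rewrite (descM cS) // (descS cS tS) // reflJ.
have dr : desc (s * w)^-1 t = desc w^-1 t (+) (t == s ^ w)%g.
  rewrite invMg (descM cS) // (invS cS sS) (descS cS sS) ?reflJ //.
  by rewrite -(inj_eq (@conjg_inj _ w) s) conjgKV eq_sym.
rewrite /lmulS /rmulS dl dr.
have [tE|ntE] := eqVneq t (s ^ w)%g; last first.
  by rewrite !addbF !mulgA; case: (desc w s); case: (desc w^-1 t) => /=; ring.
have swE : (s * w = w * t)%g by rewrite tE conjgE mulKVg.
have dE : desc w^-1 t = desc w s.
  by rewrite /desc -(invS cS tS) -invMg -swE !(clenV cS).
rewrite swE dE -!mulgA (mulSS cS tS) mulg1 !addbT.
have -> : (s * (w * t) = w)%g by rewrite -swE (mulSK cS sS).
by case: (desc w s) => /=; ring.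
Qed.

Local Notation term := (fterm R {s : W | s \in S}).

Fixpoint act (x : term) (f : W -> R) : W -> R :=
  match x with
  | FVar s => lmulS (val s) f
  | FCst r => fun w => r * f w
  | FAdd x y => fun w => act x f w + act y f w
  | FMul x y => act x (act y f)
  end.

Lemma lmulS_lin s r f g :
  lmulS s (fun w => r * f w + g w) = fun w => r * lmulS s f w + lmulS s g w.
Proof. by apply: funE => w; rewrite /lmulS; case: ifP => _; ring. Qed.

Lemma act_lin x r f g :
  act x (fun w => r * f w + g w) = fun w => r * act x f w + act x g w.
Proof.
elim: x f g => [s|c|x IHx y IHy|x IHx y IHy] f g /=.
- exact: lmulS_lin.
- by apply: funE => w; ring.
- by apply: funE => w; rewrite IHx IHy; ring.
- by rewrite IHy IHx.
Qed.

Lemma act0 x : act x (fun=> 0) = fun=> 0.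
Proof.
have := act_lin x (-1) (fun=> 0) (fun=> 0).
rewrite (_ : (fun=> -1 * 0 + 0) = fun=> 0); last by apply: funE => w; ring.
by move->; apply: funE => w; ring.
Qed.

Lemma actZ x r f : act x (fun w => r * f w) = fun w => r * act x f w.
Proof.
have := act_lin x r f (fun=> 0); rewrite act0.
rewrite (_ : (fun w => r * f w + 0) = fun w => r * f w);
  last by apply: funE => w; ring.
by move->; apply: funE => w; ring.
Qed.

Lemma actD x f g : act x (fun w => f w + g w) = fun w => act x f w + act x g w.
Proof.
have := act_lin x 1 f g.
rewrite (_ : (fun w => 1 * f w + g w) = fun w => f w + g w);
  last by apply: funE => w; ring.
by move->; apply: funE => w; ring.
Qed.

Lemma act_sum x (c : W -> R) (f : W -> W -> R) :
  act x (fun w => \sum_u c u * f u w) = fun w => \sum_u c u * act x (f u) w.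
Proof.
elim: (index_enum W) => [|u r IH].
  rewrite -[RHS](_ : act x (fun=> 0) = _).
    by congr act; apply: funE => w; rewrite big_nil.
  by rewrite act0; apply: funE => w; rewrite big_nil.
rewrite (_ : (fun w => _) = fun w => c u * f u w + \sum_(u <- r) c u * f u w).
  by rewrite act_lin IH; apply: funE => w; rewrite big_cons.
by apply: funE => w; rewrite big_cons.
Qed.

Lemma act_rmulS x t f : t \in S -> act x (rmulS t f) = rmulS t (act x f).
Proof.
move=> tS; elim: x f => [s|c|x IHx y IHy|x IHx y IHy] f /=.
- by rewrite lmulS_rmulS // (valP s).
- by apply: funE => w; rewrite /rmulS; case: ifP => _; ring.
- by apply: funE => w; rewrite IHx IHy /rmulS; case: ifP => _; ring.
- by rewrite IHy IHx.
Qed.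

Lemma lmulS_delta s u : s \in S -> ~~ desc u s ->
  lmulS s (delta u) = delta (s * u)%g.
Proof.
move=> sS nd; apply: funE => w; rewrite /lmulS /delta.
rewrite -(inj_eq (mulgI s) (s * w)%g u) (mulSK cS sS).
have [->|_] := eqVneq w (s * u)%g.
  by rewrite descMs // nd eq_mulgV1 mulgK (negPf (neqS1 cS sS)) mulr0 addr0.
have [->|_] := eqVneq w u; first by rewrite (negPf nd) mulr0.
by rewrite !mulr0 addr0 if_same.
Qed.

Lemma rmulS_delta t u : t \in S -> ~~ desc u^-1 t ->
  rmulS t (delta u) = delta (u * t)%g.
Proof.
move=> tS nd; apply: funE => w; have := lmulS_delta tS nd.
move/(congr1 (fun f => f w^-1%g)); rewrite /lmulS /rmulS /delta.
have V x y : (x^-1 == y :> W)%g = (x == y^-1)%g by apply/eqP/eqP => [<-|->];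
  rewrite invgK.
have -> : (t * w^-1)%g = (w * t)^-1%g by rewrite invMg (invS cS tS).
by rewrite !V invMg invgK (invS cS tS).
Qed.

Lemma deltaE f : f = fun w => \sum_u f u * delta u w.
Proof.
apply: funE => w; rewrite (bigD1 w) //= /delta eqxx mulr1 big1 ?addr0 // =>
  u nu.
by rewrite eq_sym (negPf nu) mulr0.
Qed.

(** The operators [act x] commute with all the [rmulS t], which produce every
    delta u from delta 1. An identity between them can thus be tested on delta
    1, where the braid relations amount to the equality of two group elements.
    *)
Lemma act_delta1_inj x y :
  act x (delta 1) = act y (delta 1) -> act x = act y.
Proof.
move=> E1; have Ed u : act x (delta u) = act y (delta u).
  rewrite -[u]invgK; have : (u^-1)%g \in <<S>>%g by rewrite (coxeter_gen cS)
    inE.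
  move: (u^-1)%g; apply: (parabolic_ind cS (subxx S)); first by rewrite invg1.
  move=> s w sS _ nd IH; rewrite invMg (invS cS sS).
  by rewrite -rmulS_delta ?invgK // !act_rmulS // IH.
apply: boolp.functional_extensionality_dep => f.
by rewrite [f]deltaE !act_sum; apply: funE => w; apply: eq_bigr => u _;
  rewrite Ed.
Qed.

(** Each letter lengthens the word by [clen_alt], so that [lmulS] only ever
    moves the support. *)
Lemma act_alternating (s t : {s : W | s \in S}) n : (n <= #[val s * val
  t]%g)%N ->
  act (alternating (FVar s) (FVar t) n) (delta 1) =
    delta (alt (val s) (val t) n).
Proof.
elim: n s t => [|n IH] s t le_n /=.
  by apply: funE => w; rewrite mul1r.
have sS := valP s; have tS := valP t.
have le_n' : (n <= #[val t * val s]%g)%N by rewrite -(order_sym cS sS tS) ltnW.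
rewrite IH //.
rewrite lmulS_delta // /desc -/(alt (val s) (val t) n.+1).
by rewrite !(clen_alt cS) // -leqNgt.
Qed.

Lemma act_eq x y : falg_eq (hecke_rel a b (S := S)) x y -> act x = act y.
Proof.
have ext (f g : (W -> R) -> W -> R) : (forall h w, f h w = g h w) -> f = g.
  by move=> E; apply: boolp.functional_extensionality_dep => h;
    apply: funE => w.
elim=> {x y} //=.
- move=> x y [s|s t st].
    by apply: ext => f w /=; rewrite lmulS_quadratic // (valP s).
  apply: act_delta1_inj; rewrite !act_alternating //.
    by rewrite (alt_sym cS) // (valP s, valP t).
  by rewrite (order_sym cS (valP t) (valP s)).
- by move=> x y z _ -> _ ->.
- by move=> x x' y y' _ -> _ ->.
- by move=> x x' y y' _ -> _ ->.
- by move=> x y z; apply: ext => f w; ring.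
- by move=> x y; apply: ext => f w; ring.
- by move=> x; apply: ext => f w; ring.
- by move=> x y z; apply: ext => f w; rewrite actD.
- by move=> x; apply: ext => f w; ring.
- by move=> x; apply: ext => f w; ring.
- by move=> r s; apply: ext => f w; ring.
- by move=> r s; apply: ext => f w; ring.
- by move=> r x; apply: ext => f w; rewrite actZ.
Qed.

Definition hact (x : H) : (W -> R) -> W -> R := act (generic_quotient.repr x).

Lemma hact_pi (x : term) : hact (\pi_(presalg (hecke_rel a b (S :=
  S)))%qT x) = act x.
Proof. by rewrite /hact; apply: act_eq; apply: repr_presalg. Qed.

End RegularRepresentation.

(** * Reduced products of generators *)
Section Matsumoto.
Local Open Scope ring_scope.

Context {R : comPzRingType} (a b : R) {W : finGroupType} (S : {set W}).
Context (cS : coxeter_system S).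
Local Notation l := (clen S).
Local Notation H := (hecke a b S).
Local Notation desc := (desc S).
Local Notation hgen := (hgen a b S).
Local Notation hact := (@hact R a b W S).
Local Notation lmulS := (lmulS a b S).

Lemma hactM (x y : H) f : hact (x * y) f = hact x (hact y f).
Proof.
elim/quotW: x => x; elim/quotW: y => y.
by rewrite [_ * _]pi_presalg_mul !hact_pi.
Qed.

Lemma hactD (x y : H) f : hact (x + y) f = fun w => hact x f w + hact y f w.
Proof.
elim/quotW: x => x; elim/quotW: y => y.
by rewrite [_ + _]pi_presalg_add !hact_pi.
Qed.

Lemma hactZ r (x : H) f : hact (r *: x) f = fun w => r * hact x f w.
Proof.
elim/quotW: x => x.
by rewrite [_ *: _]pi_presalg_mul !hact_pi.
Qed.

Lemma hact1 f : hact 1 f = f.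
Proof.
rewrite [1 in LHS]/(presalg_cst _ _) hact_pi //=.
by apply: boolp.functional_extensionality_dep => w; rewrite mul1r.
Qed.

Lemma hact_gen s f : s \in S -> hact (hgen s) f = lmulS s f.
Proof.
move=> sS; rewrite /Defs.hgen; case: insubP => [u _ us|]; last by rewrite sS.
by rewrite hact_pi //= us.
Qed.

Lemma hgenE (s : {s | s \in S}) : hgen (val s) =
  presalg_var (hecke_rel a b (S := S)) s.
Proof. by rewrite /Defs.hgen valK. Qed.

Lemma hscalerAl r (x y : H) : r *: (x * y) = (r *: x) * y.
Proof. exact: presalg_mulA. Qed.

Lemma hscalerAr r (x y : H) : r *: (x * y) = x * (r *: y).
Proof.
rewrite [LHS]presalg_mulA [RHS]presalg_mulA; congr presalg_mul.
exact: presalg_cstC.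
Qed.

Lemma hgen_quadratic s : s \in S ->
  hgen s * hgen s = a *: hgen s + b *: (1 : H).
Proof.
move=> sS; rewrite -[s in hgen s]/(val (exist _ s sS)) hgenE.
rewrite -[b *: _]/(presalg_cst _ b * 1 : H) mulr1.
rewrite [LHS]pi_presalg_mul [a *: _]pi_presalg_mul [RHS]pi_presalg_add.
exact/presalgP/falg_rel/hecke_quadratic.
Qed.

Fixpoint alt_hgen (s t : W) n : H :=
  if n is n'.+1 then hgen s * alt_hgen t s n' else 1.

Lemma alt_hgen_pi (s t : {s | s \in S}) n :
  alt_hgen (val s) (val t) n =
    \pi_(presalg (hecke_rel a b (S := S)))%qT (alternating (FVar s) (FVar t) n).
Proof.
by elim: n s t => //= n IH s t; rewrite IH hgenE [LHS]pi_presalg_mul.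
Qed.

Lemma alt_hgen_sym s t : s \in S -> t \in S ->
  alt_hgen s t #[s * t]%g = alt_hgen t s #[s * t]%g.
Proof.
move=> sS tS; have [->//|st] := eqVneq s t.
rewrite -[s in alt_hgen s t]/(val (exist _ s sS)) -[t in alt_hgen _ t]/(val
  (exist _ t tS)).
rewrite (alt_hgen_pi (exist _ s sS) (exist _ t tS)) (alt_hgen_pi (exist _ t
  tS) (exist _ s sS)).
by apply/presalgP/falg_rel/(hecke_braid a b (s := exist _ s sS) (t :=
  exist _ t tS)).
Qed.

(** One reduced word of w is chosen, a letter at a time; n is the number of
    letters still to be read. *)
Fixpoint hpi_rec n (w : W) : H :=
  if n is n'.+1 then
    if [pick s in S | desc w s] is Some s then hgen s * hpi_rec n' (s * w)%g
      else 1
  else 1.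
Definition hpi w := hpi_rec (l w) w.

Lemma hpi1 : hpi 1%g = 1.
Proof. by rewrite /hpi (clen1 cS). Qed.

Lemma hpi_pick w : w != 1%g ->
  exists s, [/\ s \in S, desc w s & hpi w = hgen s * hpi (s * w)%g].
Proof.
move=> w1; have [s0 s0S lw] := clen_split cS w1.
rewrite -[hpi w]/(hpi_rec (l w) w) lw /=;
  case: pickP => [s /andP[sS ds]|/(_ s0)]; last first.
  by rewrite s0S /desc lw leqnn.
exists s; split=> //; congr (_ * hpi_rec _ _); apply/succn_inj.
by rewrite -lw -(clen_desc cS sS ds).
Qed.

(** Matsumoto's theorem: any descent s of w may be taken as the first letter.
    Let t be the letter that was chosen. Both s and t shorten w, so by
    [lmax_mul] w is the product, with lengths adding up, of the longest element
    of <<s, t>> and of some d. By induction each of the two products is an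
    alternating product of #[s * t] generators times hpi d, and the braid
    relation identifies them. The case s = t is included, with #[s * t] = 1. *)
Lemma hpi_desc w s : s \in S -> desc w s -> hpi w = hgen s * hpi (s * w)%g.
Proof.
have [N] := ubnP (l w); elim: N w s => // N IH w s.
rewrite ltnS => lwN sS ds.
have w_neq1 : w != 1%g by apply: contraL ds => /eqP->; rewrite desc1.
have alt_le j x y d : x \in S -> y \in S -> (l (alt x y j * d)%g <= j + l d)%N.
  elim: j x y => [|j IHj] x y xS yS /=; first by rewrite mul1g.
  by rewrite -mulgA (leq_trans (clenMl cS _ _)) // ltnS IHj.
(* The length hypothesis passes to the suffixes of the alternating word, as a
   letter increases the length by at most one. *)
have alt_hgen_hpi j x y d : x \in S -> y \in S ->
  l (alt x y j * d)%g = (j + l d)%N ->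
    (l (alt x y j * d)%g < N)%N ->
      hpi (alt x y j * d)%g = alt_hgen x y j * hpi d.
  elim: j x y => [|j IHj] x y xS yS /=; first by rewrite mul1g mul1r.
  rewrite -mulgA; set z := (_ * d)%g => lz lzN.
  have le_z : (l z <= j + l d)%N by apply: alt_le.
  have lzE : l z = (j + l d)%N.
    apply/eqP; rewrite eqn_leq le_z -ltnS -addSn -lz; exact: clenMl.
  rewrite -mulrA -IHj //; last by rewrite lzE (ltn_trans _ lzN) // lz.
  have := IH (x * z)%g x lzN xS; rewrite (mulSK cS xS); apply.
  by rewrite /desc (mulSK cS xS) lz lzE.
have [t [tS dt ->]] := hpi_pick w_neq1.
set K := [set s; t]%g; have sKS : K \subset S.
  by apply/subsetP => x /set2P[] ->.
have dK x : x \in K -> desc w x by case/set2P=> ->.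
set m := #[s * t]%g; have m_gt0 : (0 < m)%N := order_gt0 _.
pose d := ((alt s t m)^-1 * w)%g.
have wE : w = (alt s t m * d)%g by rewrite mulKVg.
have wE' : w = (alt t s m * d)%g by rewrite /m -(alt_sym cS).
have lw : l w = (m + l d)%N.
  rewrite (lmax_mul cS sKS dK (v := (alt s t m)^-1)%g) ?groupV ?alt_gen //.
  by rewrite (clenV cS) (clen_alt cS).
have side x y : x \in S -> y \in S -> desc w x -> w = (alt x y m * d)%g ->
    hgen x * hpi (x * w)%g = alt_hgen x y m * hpi d.
  move=> xS yS dx E; have xw : (x * w)%g = (alt y x m.-1 * d)%g.
    by rewrite E -(prednK m_gt0) /= -mulgA (mulSK cS xS).
  have lxw : (l (x * w)%g).+1 = l w by rewrite -(clen_desc cS).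
  have lxwE : l (x * w)%g = (m.-1 + l d)%N.
    by apply/succn_inj; rewrite lxw lw -{1}(prednK m_gt0) addSn.
  rewrite xw alt_hgen_hpi -?xw //; last by rewrite (leq_trans _ lwN) // lxw.
  by rewrite mulrA -{2}(prednK m_gt0).
by rewrite (side t s) // (side s t) // /m alt_hgen_sym.
Qed.
End Matsumoto.

(** * The standard basis and the parabolic subalgebras *)
Section StandardBasis.
Local Open Scope ring_scope.

Context {R : comPzRingType} (a b : R) {W : finGroupType} (S : {set W}).
Context (cS : coxeter_system S).
Local Notation l := (clen S).
Local Notation H := (hecke a b S).
Local Notation desc := (desc S).
Local Notation hgen := (hgen a b S).
Local Notation hact := (@hact R a b W S).
Local Notation lmulS := (lmulS a b S).
Local Notation delta := (@delta R W).
Local Notation hpi := (hpi a b S).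

Lemma hgen_hpi_asc s w : s \in S -> ~~ desc w s ->
  hgen s * hpi w = hpi (s * w)%g.
Proof.
by move=> sS nd; rewrite (hpi_desc a b cS (w :=
  (s * w)%g) sS) ?(descMs cS) // (mulSK cS).
Qed.

Lemma hgen_hpi_desc s w : s \in S -> desc w s ->
  hgen s * hpi w = a *: hpi w + b *: hpi (s * w)%g.
Proof.
move=> sS ds; rewrite (hpi_desc a b cS sS ds) mulrA (hgen_quadratic a b sS).
by rewrite mulrDl -!hscalerAl mul1r.
Qed.

Lemma hpi_gen s : s \in S -> hpi s = hgen s.
Proof.
move=> sS; have := @hgen_hpi_asc s 1%g sS; rewrite desc1 // hpi1 // mulr1 mulg1.
by move->.
Qed.

Lemma hpiM u v : l (u * v)%g = (l u + l v)%N -> hpi (u * v)%g = hpi u * hpi v.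
Proof.
have : u \in <<S>>%g by rewrite (coxeter_gen cS) inE.
move: u; apply: (parabolic_ind cS (subxx S));
  first by rewrite hpi1 // mul1g mul1r.
move=> s u sS _ nd IH; rewrite -mulgA (clen_asc cS sS nd) addSn => luv.
have le_uv : (l (u * v)%g <= l u + l v)%N by rewrite clenM.
have luvE : l (u * v)%g = (l u + l v)%N.
  by apply/eqP; rewrite eqn_leq le_uv -ltnS -luv clenMl.
rewrite -(hgen_hpi_asc sS nd) -mulrA -IH // hgen_hpi_asc //.
by rewrite /desc luv luvE -leqNgt.
Qed.

(** As delta 1 represents the unit of H, this is the family of the coordinates
    of x in the basis hpi, by [hcoord_hpi] and [hcoordK]. *)
Definition hcoord (x : H) : W -> R := hact x (delta 1%g).

Lemma hcoordD x y w : hcoord (x + y) w = hcoord x w + hcoord y w.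
Proof. by rewrite /hcoord hactD. Qed.
Lemma hcoordZ r x w : hcoord (r *: x) w = r * hcoord x w.
Proof. by rewrite /hcoord hactZ. Qed.
Lemma hcoord_gen s x : s \in S -> hcoord (hgen s * x) = lmulS s (hcoord x).
Proof. by move=> sS; rewrite /hcoord hactM // hact_gen. Qed.

Lemma hcoord_hpi u : hcoord (hpi u) = delta u.
Proof.
have : u \in <<S>>%g by rewrite (coxeter_gen cS) inE.
move: u; apply: (parabolic_ind cS (subxx S));
  first by rewrite hpi1 // /hcoord hact1.
by move=> s u sS _ nd IH; rewrite -hgen_hpi_asc // hcoord_gen // IH lmulS_delta.
Qed.

Definition lincomb (f : W -> R) : H := \sum_w f w *: hpi w.

Lemma lincombD f g : lincomb (fun w => f w + g w) = lincomb f + lincomb g.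
Proof. by rewrite -big_split; apply: eq_bigr => w _; rewrite scalerDl. Qed.

Lemma lincomb_delta u : lincomb (delta u) = hpi u.
Proof.
rewrite /lincomb (bigD1 u) //= /delta eqxx scale1r big1 ?addr0 // => w nw.
by rewrite (negPf nw) scale0r.
Qed.

Lemma lincomb_gen s f : s \in S -> hgen s * lincomb f = lincomb (lmulS s f).
Proof.
move=> sS.
(* In hgen s * hpi w the terms p w, at w, and q (s * w), at s * w, are kept
   apart, so that the sum of the latter can be reindexed by w |-> s * w. *)
pose p w : H := if desc w s then a *: hpi w else 0.
pose q w : H := if desc w s then hpi w else b *: hpi w.
have E w : hgen s * hpi w = p w + q (s * w)%g.
  rewrite /p /q descMs //; case: ifP => ds; first by rewrite hgen_hpi_desc.
  by rewrite add0r hgen_hpi_asc ?ds.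
transitivity (\sum_w f w *: p w + \sum_w f w *: q (s * w)%g).
  rewrite mulr_sumr -big_split; apply: eq_bigr => w _.
  by rewrite -hscalerAr E scalerDr.
rewrite [X in _ + X](reindex_inj (mulgI s)) -big_split;
  apply: eq_bigr => w _ /=.
rewrite (mulSK cS sS) /p /q /lmulS; case: ifP => _.
  by rewrite scalerA scalerDl (mulrC a) addrC.
by rewrite scaler0 add0r scalerA mulrC.
Qed.

(** Linear combinations of the hpi are stable under left multiplication.
    Applied to the unit, this shows that every x is such a combination, with
    coefficients the coordinates of x. *)
Lemma lincomb_act x f : x * lincomb f = lincomb (hact x f).
Proof.
elim/quotW: x => x; rewrite hact_pi //.
elim: x f => [s|c|x IHx y IHy|x IHx y IHy] f /=.
- by rewrite -lincomb_gen ?(valP s) // hgenE.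
- rewrite -[LHS]/(c *: lincomb f) scaler_sumr; apply: eq_bigr => w _.
  by rewrite scalerA.
- by rewrite lincombD -IHx -IHy -mulrDl [in RHS]/GRing.add /= pi_presalg_add.
- by rewrite -IHx -IHy mulrA [in RHS]/GRing.mul /= pi_presalg_mul.
Qed.

Lemma hcoordK x : \sum_w hcoord x w *: hpi w = x.
Proof. by rewrite -/(lincomb _) -lincomb_act lincomb_delta hpi1 // mulr1. Qed.

Lemma hcoord_inj x y : hcoord x = hcoord y -> x = y.
Proof. by move=> E; rewrite -(hcoordK x) -(hcoordK y) E. Qed.

Section Parabolic.
Context (K : {set W}) (sKS : K \subset S).
Local Notation HK := (@hecke_par_pred R a b W S K).

Lemma hpi_par w : w \in <<K>>%g -> hpi w \in HK.
Proof.
move: w; apply: (parabolic_ind cS sKS); first by rewrite hpi1 // rpred1.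
move=> s w sK _ nd wK; rewrite -hgen_hpi_asc ?(subsetP sKS) //.
by rewrite rpredM // hgen_par.
Qed.

(** The elements with coordinates supported on <<K>> form a subalgebra that
    contains the generators indexed by K. *)
Lemma hcoord_par x w : x \in HK -> w \notin <<K>>%g -> hcoord x w = 0.
Proof.
pose P : {pred H} := fun x => boolp.asbool (forall w, w \notin <<K>>%g ->
  hcoord x w = 0).
have lin r y z : y \in P -> z \in P -> r *: y + z \in P.
  move=> /boolp.asboolP Px /boolp.asboolP Py; apply/boolp.asboolP => v vK.
  by rewrite hcoordD hcoordZ Px ?Py // mulr0 addr0.
have P0 : 0 \in P.
  apply/boolp.asboolP => v vK.
  have := hcoordD 0 0 v; rewrite addr0 => /eqP;
    rewrite -subr_eq subrr => /eqP <-//.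
have Psum f : (forall v, v \in <<K>>%g -> f v \in P) ->
    forall c : W -> R, (forall v, v \notin <<K>>%g -> c v = 0) ->
      \sum_v c v *: f v \in P.
  move=> Pf c c0; elim/big_ind: _ => //; first by move=> x1 y1 /(lin 1 x1 y1);
    rewrite scale1r.
  move=> v _; have [vK|/c0->] := boolP (v \in <<K>>%g); last by rewrite scale0r.
  by rewrite -[_ *: _]addr0 lin ?Pf.
have Pgen s y : s \in K -> y \in P -> hgen s * y \in P.
  move=> sK /boolp.asboolP Py; apply/boolp.asboolP => v vK.
  have svK : (s * v)%g \notin <<K>>%g by rewrite groupMl // mem_gen.
  by rewrite hcoord_gen ?(subsetP sKS) // /lmulS !Py // !mulr0 addr0 if_same.
move/boolp.asboolP/(_ P) => Px wK; suff /boolp.asboolP : x \in P by apply.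
apply: Px => [|s sK]; last first.
  apply/boolp.asboolP=> v vK;
    rewrite -hpi_gen ?(subsetP sKS) // hcoord_hpi /delta.
  by case: eqP => // vs; move: vK; rewrite vs mem_gen.
split=> // [|y z Py Pz].
  apply/boolp.asboolP=> v vK; rewrite -hpi1 // hcoord_hpi /delta.
  by case: eqP => // vs; move: vK; rewrite vs group1.
rewrite -[y]hcoordK mulr_suml.
rewrite (eq_bigr (fun v => hcoord y v *: (hpi v * z))); last by move=> v _;
  rewrite hscalerAl.
apply: Psum; last by move/boolp.asboolP: Py.
apply: (parabolic_ind cS sKS); first by rewrite hpi1 // mul1r.
by move=> s v sK _ nd IH; rewrite -hgen_hpi_asc ?(subsetP sKS) // -mulrA Pgen.
Qed.

End Parabolic.
End StandardBasis.

(** * Induced modules *)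
Section Additive.
Local Open Scope ring_scope.

Lemma zmod_morphism_sum (U V : zmodType) (f : U -> V) : zmod_morphism f ->
  forall (I : Type) (r : seq I) (P : pred I) (F : I -> U),
  f (\sum_(j <- r | P j) F j) = \sum_(j <- r | P j) f (F j).
Proof.
move=> fB I r P F; have f0 : f 0 = 0 by rewrite -[RHS](subrr (f 0)) -fB subrr.
apply: (big_morph f _ f0) => x y; rewrite -{1}[y]opprK fB; congr (_ + _).
by rewrite -[- y]sub0r fB f0 sub0r opprK.
Qed.

Lemma lmod_isoI (A : pzRingType) (U V : lmodType A) (f : U -> V) (g : V -> U) :
  linear f -> cancel f g -> cancel g f -> lmod_iso U V.
Proof.
move=> lf fK gK.
pose F : {linear U -> V} := HB.pack f (GRing.isLinear.Build _ U V _ f lf).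
by exists F; exists g.
Qed.
End Additive.

Section Tensor.
Local Open Scope ring_scope.

Context {B A : pzRingType} (i : {rmorphism B -> A}) (N : lmodType B).
Local Notation ind := (induced i N).

Definition tens (x : A) (n : N) : ind := (\pi_(induced i N) (TPure x n))%qT.

Lemma tensDl x y n : tens (x + y) n = tens x n + tens y n.
Proof. by rewrite [RHS]pi_induced_add; apply/inducedP/tensor_Dl. Qed.
Lemma tensDr x m n : tens x (m + n) = tens x m + tens x n.
Proof. by rewrite [RHS]pi_induced_add; apply/inducedP/tensor_Dr. Qed.
Lemma tens_bal x y n : tens (x * i y) n = tens x (y *: n).
Proof. exact/inducedP/tensor_balanced. Qed.
Lemma tensZ z x n : z *: tens x n = tens (z * x) n.
Proof. exact: pi_induced_scale. Qed.

Lemma tens_indB (P : ind -> Prop) :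
  P 0 -> (forall y z, P y -> P z -> P (y - z)) ->
  (forall x n, P (tens x n)) -> forall y, P y.
Proof.
move=> P0 PB Pt; have PN y : P y -> P (- y) by rewrite -(sub0r y); apply: PB.
elim/quotW=> y; elim: y => [|x n|x IHx|x IHx y IHy]; [exact: P0|exact: Pt| |].
- by rewrite -pi_induced_opp; apply: PN.
- by rewrite -pi_induced_add -[induced_add _ _]/(_ + _) -[X in _ + X]opprK;
  apply/PB/PN.
Qed.

Lemma tens_suml (I : Type) (r : seq I) (P : pred I) (F : I -> A) n :
  tens (\sum_(j <- r | P j) F j) n = \sum_(j <- r | P j) tens (F j) n.
Proof.
apply: (big_morph (tens^~ n)) => [x y|]; first exact: tensDl.
by apply: (addrI (tens 0 n)); rewrite -tensDl !addr0.
Qed.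

Section Lift.
Context {V : zmodType} (g : A -> N -> V).

Fixpoint tterm_eval (t : tterm A N) : V :=
  match t with
  | TZero => 0
  | TPure x n => g x n
  | TOpp t => - tterm_eval t
  | TAdd t u => tterm_eval t + tterm_eval u
  end.

(** The universal property of the tensor product: a balanced biadditive g
    factors through it. *)
Definition tens_map (y : ind) : V := tterm_eval (generic_quotient.repr y).

Context (gDl : forall x y n, g (x + y) n = g x n + g y n).
Context (gDr : forall x m n, g x (m + n) = g x m + g x n).
Context (gB : forall x y n, g (x * i y) n = g x (y *: n)).

Lemma tterm_eval_eq t u : tensor_eq i t u -> tterm_eval t = tterm_eval u.
Proof.
elim=> {t u} //=.
- by move=> x y z _ -> _ ->.
- by move=> x y _ ->.
- by move=> x x' y y' _ -> _ ->.
- by move=> *; rewrite addrA.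
- by move=> *; rewrite addrC.
- by move=> *; rewrite add0r.
- by move=> *; rewrite addNr.
Qed.

Lemma tens_map_pi t : tens_map (\pi_(induced i N) t)%qT = tterm_eval t.
Proof. by apply: tterm_eval_eq; apply: repr_induced. Qed.

Lemma tens_mapE x n : tens_map (tens x n) = g x n.
Proof. exact: tens_map_pi. Qed.

Lemma tens_map_zmod : zmod_morphism tens_map.
Proof.
elim/quotW=> y; elim/quotW=> z.
by rewrite [- _]pi_induced_opp [_ + _ in LHS]pi_induced_add !tens_map_pi.
Qed.

Lemma tens_map_act z (h : V -> V) : zmod_morphism h ->
  (forall x n, g (z * x) n = h (g x n)) ->
  forall y, tens_map (z *: y) = h (tens_map y).
Proof.
move=> hB gz; have h0 : h 0 = 0 by rewrite -[RHS](subrr (h 0)) -hB subrr.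
have m0 : tens_map 0 = 0.
  by rewrite -[RHS](subrr (tens_map 0)) -tens_map_zmod subrr.
elim/tens_indB => [|y y' IH IH'|x n]; first by rewrite scaler0 m0 h0.
  by rewrite scalerBr !tens_map_zmod IH IH' hB.
by rewrite tensZ !tens_mapE.
Qed.
End Lift.

Section Free.
Context {T : finType} (D : pred T) (e : T -> A) (c : T -> A -> B).
Context (cD : forall d, {morph c d : x y / x + y}).
Context (ce : forall d d' y, D d -> D d' ->
  c d (e d' * i y) = if d == d' then y else 0).
Context (ec : forall x, x = \sum_(d | D d) e d * i (c d x)).

(** It suffices to check right linearity on the generators e d. *)
Lemma free_coordM d x y : D d -> c d (x * i y) = c d x * y.
Proof.
move=> Dd; have c0 : c d 0 = 0 by apply: (addrI (c d 0)); rewrite -cD !addr0.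
rewrite {1}(ec x) mulr_suml (big_morph (c d) (@cD d) c0) (bigD1 d) //=.
rewrite -mulrA -rmorphM ce // eqxx big1 ?addr0 // => d' /andP[Dd' nd].
by rewrite -mulrA -rmorphM ce // eq_sym (negPf nd).
Qed.

(** If A is a free right B-module on the e d, then each element of the tensor
    product is uniquely a sum of e d (x) n_d. The n_d of x (x) n is the
    coordinate of x at d, acting on n. *)
Definition tcoord d : ind -> N := tens_map (fun x n => c d x *: n).

Lemma tcoordE d x n : D d -> tcoord d (tens x n) = c d x *: n.
Proof.
move=> Dd; apply: tens_mapE => [{}x y m|{}x m m'|{}x y m].
- by rewrite cD scalerDl.
- by rewrite scalerDr.
- by rewrite free_coordM // scalerA.
Qed.

Lemma tcoord_zmod d : D d -> zmod_morphism (tcoord d).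
Proof.
move=> Dd; apply: tens_map_zmod => [x y m|x m m'|x y m].
- by rewrite cD scalerDl.
- by rewrite scalerDr.
- by rewrite free_coordM // scalerA.
Qed.

Lemma tcoord_basis d d' n : D d -> D d' ->
  tcoord d (tens (e d') n) = if d == d' then n else 0.
Proof.
move=> Dd Dd'; rewrite tcoordE // -[e d']mulr1 -(rmorph1 i) ce //.
by case: ifP => _; rewrite ?scale1r ?scale0r.
Qed.

Lemma tcoord_sum y : y = \sum_(d | D d) tens (e d) (tcoord d y).
Proof.
have sub x z : \sum_(d | D d) tens (e d) (tcoord d (x - z)) =
    \sum_(d | D d) tens (e d) (tcoord d x) - \sum_(d | D d) tens (e d) (tcoord
      d z).
  rewrite -sumrB; apply: eq_bigr => d Dd; apply/eqP; rewrite eq_sym subr_eq.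
  by rewrite -tensDr tcoord_zmod // subrK.
elim/tens_indB: y => [|x z IHx IHz|x n].
- by have := sub 0 0; rewrite subr0 subrr.
- by rewrite sub -IHx -IHz.
rewrite {1}(ec x) tens_suml; apply: eq_bigr => d Dd.
by rewrite tens_bal tcoordE.
Qed.
End Free.
End Tensor.

(** * Freeness over a parabolic subalgebra *)

Section HeckeFree.
Local Open Scope ring_scope.

Context {R : comPzRingType} (a b : R) {W : finGroupType} (S : {set W}).
Context (cS : coxeter_system S).
Local Notation H := (hecke a b S).
Local Notation HK K := (hecke_par a b S K).
Local Notation hpi := (hpi a b S).
Local Notation hcoord := (@hcoord R a b W S).

Lemma hcoord0 w : hcoord 0 w = 0.
Proof. by apply: (addrI (hcoord 0 w)); rewrite -hcoordD // !addr0. Qed.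

Lemma hcoord_sum (I : Type) (r : seq I) (P : pred I) (F : I -> H) w :
  hcoord (\sum_(j <- r | P j) F j) w = \sum_(j <- r | P j) hcoord (F j) w.
Proof.
by apply: (big_morph (hcoord^~ w)) => [x y|]; [apply: hcoordD | apply: hcoord0].
Qed.

Lemma val_parD (K : {set W}) (x y : HK K) : val (x + y) = val x + val y :> H.
Proof. exact: raddfD. Qed.
Lemma val_parZ (K : {set W}) r (x : HK K) : val (r *: x) = r *: val x :> H.
Proof. exact: linearZ_LR. Qed.

Section OneSided.
Context (K : {set W}) (sKS : K \subset S).

(** The default value 0 is only taken outside the subalgebra. *)
Definition to_par (x : H) : HK K := insubd 0 x.

Lemma to_parK x : x \in hecke_par_pred K -> val (to_par x) = x.
Proof. by move=> xK; rewrite val_insubd xK. Qed.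

(** As each w is d v for unique d in W^K and v in <<K>>, with pi_w = pi_d pi_v,
    grouping the coordinates of x by d gives x as a sum of pi_d times elements
    of the subalgebra of K. *)
Definition rcoord (d : W) (x : H) : HK K :=
  to_par (\sum_(v in <<K>>%g) hcoord x (d * v)%g *: hpi v).

Lemma val_rcoord d x :
  val (rcoord d x) = \sum_(v in <<K>>%g) hcoord x (d * v)%g *: hpi v.
Proof. by rewrite to_parK // rpred_sum // => v vK; rewrite rpredZ ?hpi_par. Qed.

Lemma hcoord_rcoord d x u :
  hcoord (val (rcoord d x)) u = if u \in <<K>>%g then hcoord x (d * u)%g else 0.
Proof.
have E v : hcoord (hcoord x (d * v)%g *: hpi v) u =
  hcoord x (d * v)%g * (u == v)%:R.
  by rewrite hcoordZ // hcoord_hpi.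
rewrite val_rcoord hcoord_sum; case: ifP => uK; last first.
  rewrite big1 // => v vK; rewrite E; case: eqP => [uv|]; last by rewrite mulr0.
  by rewrite uv vK in uK.
rewrite (bigD1 u) //= E eqxx mulr1 big1 ?addr0 // => v /andP[_ nv].
by rewrite E eq_sym (negPf nv) mulr0.
Qed.

Lemma rcoordD d : {morph rcoord d : x y / x + y}.
Proof.
move=> x y; apply: val_inj; apply: (hcoord_inj cS);
  apply: boolp.functional_extensionality_dep => u.
rewrite raddfD hcoordD // !hcoord_rcoord hcoordD //.
by case: ifP => // _; rewrite addr0.
Qed.

Lemma rcoordZ d r x : rcoord d (r *: x) = r *: rcoord d x.
Proof.
apply: val_inj; apply: (hcoord_inj cS);
  apply: boolp.functional_extensionality_dep => u.
rewrite [val (r *: _)]linearZ_LR hcoordZ // !hcoord_rcoord hcoordZ //.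
by case: ifP => // _; rewrite mulr0.
Qed.

(** Left multiplication by hpi d translates the support of y by d, since pi_d
    pi_v = pi_(d v) for v in <<K>>. *)
Lemma hcoord_hpi_mul d y w : rmin S K d -> y \in hecke_par_pred K ->
  hcoord (hpi d * y) w = hcoord y (d^-1 * w)%g.
Proof.
move=> dm yK; rewrite -{1}(hcoordK cS y) mulr_sumr hcoord_sum (bigD1 (d^-1 *
  w)%g) //=.
have E v : hcoord (hpi d * (hcoord y v *: hpi v)) w =
  hcoord y v * (w == d * v)%g%:R.
  rewrite -hscalerAr hcoordZ //; have [vK|vK] := boolP (v \in <<K>>%g).
    by rewrite -hpiM ?hcoord_hpi // (rmin_mul cS sKS).
  by rewrite (hcoord_par cS sKS yK vK) !mul0r.
rewrite E mulKVg eqxx mulr1 big1 ?addr0 // => v nv; rewrite E.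
have [wE|_] := eqVneq w (d * v)%g; last by rewrite mulr0.
by rewrite wE mulKg eqxx in nv.
Qed.

Lemma rcoord_hpi d d' (y : HK K) : rmin S K d -> rmin S K d' ->
  rcoord d (hpi d' * val y) = if d == d' then y else 0.
Proof.
move=> dm dm'; apply: val_inj; apply: (hcoord_inj cS).
apply: boolp.functional_extensionality_dep => u.
rewrite hcoord_rcoord hcoord_hpi_mul ?(valP y) //.
have [<-|ndd] := eqVneq d d'.
  by rewrite mulKg; case: ifP => // /negbT uK;
    rewrite (hcoord_par cS sKS (valP y) uK).
rewrite raddf0 hcoord0; case: ifP => // uK.
apply: (hcoord_par cS sKS (valP y)); apply: contraNN ndd => d'du; apply/eqP.
have [] := rmin_inj cS sKS dm dm' uK d'du _ => //.
by rewrite mulKVg.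
Qed.

Lemma rcoord_sum x : x = \sum_(d | rmin S K d) hpi d * val (rcoord d x).
Proof.
apply: (hcoord_inj cS); apply: boolp.functional_extensionality_dep => w.
have [d [v [dm vK wE]]] := rmin_split cS K w.
have dwK : (d^-1 * w)%g \in <<K>>%g by rewrite wE mulKg.
have E d' : rmin S K d' -> hcoord (hpi d' * val (rcoord d' x)) w =
    if (d'^-1 * w)%g \in <<K>>%g then hcoord x w else 0.
  move=> dm'; rewrite hcoord_hpi_mul ?(valP (rcoord _ _)) // hcoord_rcoord.
  by rewrite mulKVg.
rewrite hcoord_sum (bigD1 d) //= E // dwK big1 ?addr0 // => d' /andP[dm' nd].
rewrite E //; case: ifP => // d'K; case/eqP: nd.
by have [] := rmin_inj cS sKS dm' dm d'K dwK _; rewrite // !mulKVg.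
Qed.

End OneSided.
End HeckeFree.

(** * Twisting by a double coset representative *)
Section Twist.
Local Open Scope ring_scope.

Context {R : comPzRingType} (a b : R) {W : finGroupType} (S : {set W}).
Context (cS : coxeter_system S).
Local Notation H := (hecke a b S).
Local Notation HK K := (hecke_par a b S K).
Local Notation hgen := (hgen a b S).
Local Notation hpi := (hpi a b S).
Local Notation rcoord := (@rcoord R a b W S).
Local Notation to_par := (@to_par R a b W S).

Lemma rcoord_par_basis (K J : {set W}) (sKJ : K \subset J) (sJS : J \subset S)
  d d' (y : HK K) :
    (d \in <<J>>%g) && rmin S K d -> (d' \in <<J>>%g) && rmin S K d' ->
  rcoord K d (val (to_par J (hpi d') * par_incl sKJ y)) =
    if d == d' then y else 0.
Proof.
have sKS := subset_trans sKJ sJS.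
move=> /andP[_ dm] /andP[d'J dm']; rewrite rmorphM /= to_parK ?hpi_par //.
by rewrite rcoord_hpi.
Qed.

(** The coordinates of an element of the subalgebra of J vanish outside <<J>>,
    so only the indices d in <<J>> contribute. *)
Lemma rcoord_par_sum (K J : {set W}) (sKJ : K \subset J) (sJS : J \subset S)
  (x : HK J) :
  x = \sum_(d | (d \in <<J>>%g) && rmin S K d)
        to_par J (hpi d) * par_incl sKJ (rcoord K d (val x)).
Proof.
have sKS := subset_trans sKJ sJS.
apply: val_inj; rewrite raddf_sum /= {1}(rcoord_sum cS sKS (val x)).
rewrite (bigID (mem <<J>>%g)) /= [X in _ + X]big1 ?addr0.
  apply: eq_big => [d|d /andP[dm dJ]]; first exact: andbC.
  by rewrite (to_parK (hpi_par a b cS sJS dJ)).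
move=> d /andP[dm dJ]; rewrite [rcoord K d _](_ : _ = 0) ?mulr0 //.
apply: val_inj; apply: (hcoord_inj cS);
  apply: boolp.functional_extensionality_dep => u.
rewrite raddf0 hcoord0 // hcoord_rcoord //; case: ifP => // uK.
apply: (hcoord_par cS sJS (valP x)).
by rewrite groupMr // (subsetP (genS sKJ)).
Qed.

Section Conj.
Context (K L : {set W}) (t : W) (sKS : K \subset S) (sLS : L \subset S).
Context (tK : lmin S K t) (tL : rmin S L t) (KL : (K :^ t)%g = L).

(** Lengths add up in both products, so both sides are equal to hpi (k t) = hpi
    (t (k ^ t)). *)
Lemma hgen_conj k : k \in K -> hgen k * hpi t = hpi t * hgen (k ^ t)%g.
Proof.
move=> kK; have ktL : (k ^ t)%g \in L by rewrite -KL memJ_conjg.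
have kS := subsetP sKS k kK; have ktS := subsetP sLS _ ktL.
rewrite -!hpi_gen // -!hpiM // ?(rmin_mul cS sLS tL) ?mem_gen //.
  by rewrite conjgE mulKVg.
by rewrite (lmin_mul cS sKS tK) ?mem_gen.
Qed.

(** Conjugation by t is characterized by the relation x pi_t = pi_t y. Although
    pi_t is not invertible in general, y is determined by pi_t y, from which it
    is recovered as the coordinate at t. *)
Definition ctau (x : HK K) : HK L := rcoord L t (val x * hpi t).

(** The x such that x pi_t belongs to pi_t H_L form a subalgebra, which
    contains the generators indexed by K by [hgen_conj]. *)
Lemma ctauP x : val x * hpi t = hpi t * val (ctau x).
Proof.
pose P : {pred H} := fun x =>
  boolp.asbool (exists y : HK L, x * hpi t = hpi t * val y).
suff /boolp.asboolP[y E] : val x \in P by rewrite /ctau E rcoord_hpi // eqxx.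
have /boolp.asboolP := valP x; apply.
  split=> [|r u v /boolp.asboolP[y yE] /boolp.asboolP[z zE]|u v
    /boolp.asboolP[y yE] /boolp.asboolP[z zE]].
  - by apply/boolp.asboolP; exists 1; rewrite mul1r rmorph1 mulr1.
  - apply/boolp.asboolP; exists (r *: y + z); rewrite val_parD val_parZ.
    by rewrite mulrDl mulrDr -hscalerAl -hscalerAr yE zE.
  - by apply/boolp.asboolP; exists (y * z);
    rewrite rmorphM /= -mulrA zE mulrA yE mulrA.
move=> k kK; have ktL : (k ^ t)%g \in L by rewrite -KL memJ_conjg.
by apply/boolp.asboolP; exists (pgen a b S ktL); apply: hgen_conj.
Qed.

Lemma ctau_uniq x y : val x * hpi t = hpi t * val y -> ctau x = y.
Proof. by move=> E; rewrite /ctau E rcoord_hpi // eqxx. Qed.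

Lemma ctau_zmod : zmod_morphism ctau.
Proof.
move=> x y; apply: ctau_uniq.
by rewrite [val _]raddfB [val (ctau _ - _)]raddfB mulrBl mulrBr !ctauP.
Qed.

Lemma ctau_monoid : monoid_morphism ctau.
Proof.
split=> [|x y]; apply: ctau_uniq; first by rewrite !rmorph1 mul1r mulr1.
by rewrite !rmorphM /= -mulrA ctauP mulrA ctauP mulrA.
Qed.

Definition ctau_rmorphism : {rmorphism HK K -> HK L} :=
  HB.pack ctau (GRing.isZmodMorphism.Build _ _ ctau ctau_zmod)
    (GRing.isMonoidMorphism.Build _ _ ctau ctau_monoid).

Lemma ctauZ r x : ctau (r *: x) = r *: ctau x.
Proof. by rewrite /ctau val_parZ -hscalerAl rcoordZ. Qed.

Lemma ctau_gen k (kK : k \in K) : val (ctau (pgen a b S kK)) = hgen (k ^ t)%g.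
Proof.
have ktL : (k ^ t)%g \in L by rewrite -KL memJ_conjg.
by rewrite (@ctau_uniq _ (pgen a b S ktL)) //; apply: hgen_conj.
Qed.
End Conj.
End Twist.

(** * The decomposition of the restricted induced module *)
Section Mackey.
Local Open Scope ring_scope.

Context {R : comPzRingType} (a b : R) {W : finGroupType} (S : {set W}).
Context (cS : coxeter_system S) (J I : {set W}).
Context (sJS : J \subset S) (sIS : I \subset S).
Local Notation H := (hecke a b S).
Local Notation HK K := (hecke_par a b S K).
Local Notation hpi := (hpi a b S).
Local Notation rcoord := (@rcoord R a b W S).
Local Notation to_par := (@to_par R a b W S).
Local Notation rep := {w : W | w \in min_dcoset_reps S J I}.
Local Notation K t := (dcosetK J I (val t)).

Lemma lmin_sub (L L' : {set W}) t : L \subset L' -> lmin S L' t -> lmin S L t.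
Proof.
by move=> /subsetP sL /forall_inP tm; apply/forall_inP => s /sL /tm.
Qed.

Let sKS (t : rep) : K t \subset S. Proof. exact: dcosetK_J. Qed.
Let sKtS (t : rep) : (K t :^ val t)%g \subset S.
Proof. exact: subset_trans (dcosetK_conj_sub J I (val t)) sIS. Qed.
Let rep_lmin (t : rep) : lmin S (K t) (val t).
Proof. exact: lmin_sub (dcosetK_subl J I _) (dcoset_rep_lmin (valP t)). Qed.
Let rep_rmin (t : rep) : rmin S (K t :^ val t)%g (val t).
Proof. exact: lmin_sub (dcosetK_conj_sub J I _) (dcoset_rep_rmin cS (valP t)).
  Qed.

Definition dcoset_twist (t : rep) : {rmorphism HK (K t) ->
  HK (K t :^ val t)%g} :=
  ctau_rmorphism a b cS (sKS t) (sKtS t) (rep_lmin t) (rep_rmin t) erefl.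

Lemma dcoset_twistP t (x : HK (K t)) :
  val x * hpi (val t) = hpi (val t) * val (dcoset_twist t x).
Proof. exact: (ctauP cS (sKS t) (sKtS t) (rep_lmin t) (rep_rmin t) erefl). Qed.

Lemma dcoset_twistZ t r (x : HK (K t)) : dcoset_twist t (r *: x) =
  r *: dcoset_twist t x.
Proof. exact: (ctauZ cS (val t) (sKtS t)). Qed.

Lemma dcoset_twist_gen t k (kK : k \in K t) :
  val (dcoset_twist t (pgen a b S kK)) = hgen a b S (k ^ val t)%g.
Proof. exact: (ctau_gen _ _ cS (sKS t) (sKtS t) (rep_lmin t) (rep_rmin t)
  erefl). Qed.

Context (M : lmodType (HK I)).
Local Notation indM := (induced (val : HK I -> H) M).
Local Notation resM t :=
  (twist (dcoset_twist t) (twist (par_incl (dcosetK_conj_sub J I (val t))) M)).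
Local Notation part t :=
  (induced (par_incl (dcosetK_subl J I (val t))) (resM t)).

Local Notation inclJ t := (par_incl (dcosetK_subl J I (val t))).
Local Notation inclI t := (par_incl (dcosetK_conj_sub J I (val t))).
Local Notation valI := (val : HK I -> H).

Definition part_map (t : rep) : part t -> indM :=
  tens_map (fun x (m : resM t) => tens valI (val x * hpi (val t)) m).

(** This is the compatibility of x (x) m |-> x pi_t (x) m with the tensor
    product over the subalgebra of K(t); it comes from pi_k pi_t = pi_t pi_(k ^
    t). *)
Lemma part_map_balanced t (x : HK J) y (m : resM t) :
  tens valI (val (x * inclJ t y) * hpi (val t)) m =
  tens valI (val x * hpi (val t)) (y *: m : resM t).
Proof.
rewrite rmorphM /= -mulrA dcoset_twistP mulrA.
exact: (tens_bal valI _ (inclI t (dcoset_twist t y))).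
Qed.

Lemma part_mapE t x m : part_map (tens (inclJ t) x m) =
  tens valI (val x * hpi (val t)) m.
Proof.
apply: tens_mapE => [{}x y n|{}x {}m n|{}x y n]; last exact: part_map_balanced.
- by rewrite val_parD mulrDl tensDl.
- by rewrite tensDr.
Qed.

Lemma part_map_zmod t : zmod_morphism (@part_map t).
Proof.
apply: tens_map_zmod => [x y n|x m n|x y n]; last exact: part_map_balanced.
- by rewrite val_parD mulrDl tensDl.
- by rewrite tensDr.
Qed.

HB.instance Definition _ t :=
  GRing.isZmodMorphism.Build (part t) indM (@part_map t) (@part_map_zmod t).

Lemma part_mapZ (t : rep) (x : HK J) (z : part t) : part_map (x *: z : part t)
  = val x *: part_map z.
Proof.
apply: tens_map_act => [{}x y n|{}x m n|{}x y n|y n|y n].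
- by rewrite val_parD mulrDl tensDl.
- by rewrite tensDr.
- exact: part_map_balanced.
- exact: scalerBr.
- by rewrite tensZ rmorphM mulrA.
Qed.

(** The products u t, for t a representative and u in the left part of t, run
    through W^I without repetition. *)
Definition left_part (t : rep) (u : W) := (u \in <<J>>%g) && rmin S (K t) u.

Lemma left_part_rmin t u : left_part t u -> rmin S I (u * val t)%g.
Proof. by case/andP=> uJ um; apply: rmin_dcoset (valP t) uJ um. Qed.

Definition topcoord (d : W) : indM -> M := tcoord (fun d => rcoord I d) d.
Definition partcoord (t : rep) (u : W) : part t -> resM t :=
  tcoord (fun d x => rcoord (K t) d (val x)) u.

Lemma topcoord_basis d d' n : rmin S I d -> rmin S I d' ->
  topcoord d (tens valI (hpi d') n) = if d == d' then n else 0.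
Proof.
apply: tcoord_basis => [{}d|{}d {}d' y|].
- exact: rcoordD.
- exact: rcoord_hpi.
- exact: rcoord_sum.
Qed.

Lemma topcoord_zmod d : rmin S I d -> zmod_morphism (topcoord d).
Proof.
apply: tcoord_zmod => [{}d|{}d d' y|].
- exact: rcoordD.
- exact: rcoord_hpi.
- exact: rcoord_sum.
Qed.

Lemma topcoord_sum y : y =
  \sum_(d | rmin S I d) tens valI (hpi d) (topcoord d y).
Proof.
apply: tcoord_sum => [d|d d' z|].
- exact: rcoordD.
- exact: rcoord_hpi.
- exact: rcoord_sum.
Qed.

Lemma partcoord_basis t u u' (n : resM t) : left_part t u -> left_part t u' ->
  partcoord u (tens (inclJ t) (to_par J (hpi u')) n) = if u == u' then n else 0.
Proof.
apply: (tcoord_basis (D := left_part t) (e :=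
  fun d => to_par J (hpi d))) => [d x y|{}u {}u' y|x].
- by rewrite val_parD (rcoordD cS (dcosetK_J I sJS _)).
- exact: rcoord_par_basis.
- exact: rcoord_par_sum.
Qed.

Lemma partcoord_zmod t u : left_part t u -> zmod_morphism (@partcoord t u).
Proof.
apply: (tcoord_zmod (D := left_part t) (e :=
  fun d => to_par J (hpi d))) => [d x y|{}u u' y|x].
- by rewrite val_parD (rcoordD cS (dcosetK_J I sJS _)).
- exact: rcoord_par_basis.
- exact: rcoord_par_sum.
Qed.

Lemma partcoord_sum t (z : part t) :
  z = \sum_(u | left_part t u) tens (inclJ t) (to_par J (hpi u)) (partcoord u
    z).
Proof.
apply: (tcoord_sum (D := left_part t) (e :=
  fun d => to_par J (hpi d))) => [d x y|u u' y|x].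
- by rewrite val_parD (rcoordD cS (dcosetK_J I sJS _)).
- exact: rcoord_par_basis.
- exact: rcoord_par_sum.
Qed.

Lemma part_map_sum t (z : part t) :
  part_map z = \sum_(u | left_part t u) tens valI (hpi (u * val t)%g)
    (partcoord u z).
Proof.
rewrite {1}(partcoord_sum z) raddf_sum; apply: eq_bigr => u /andP[uJ um].
apply: etrans (part_mapE _ _) _; rewrite to_parK ?hpi_par // -hpiM //.
by rewrite (lmin_mul cS sJS (dcoset_rep_lmin (valP t)) uJ).
Qed.

Definition mackey_map (z : dsum (fun t : rep => part t)) : indM :=
  \sum_t part_map (z t).

Lemma mackey_map_linear x z z' :
  mackey_map (x *: z + z') = val x *: mackey_map z + mackey_map z'.
Proof.
rewrite scaler_sumr -big_split; apply: eq_bigr => t _.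
by rewrite -part_mapZ; apply: (raddfD (@part_map t)).
Qed.

(** The map sends pi_u (x) m at t to pi_(u t) (x) m, so it preserves
    coordinates along the bijection (t, u) |-> u t. *)
Lemma topcoord_mackey t u z : left_part t u ->
  topcoord (u * val t)%g (mackey_map z) = partcoord u (z t).
Proof.
move=> Du; have dm := left_part_rmin Du.
have pE := zmod_morphism_sum (topcoord_zmod dm).
have expand t' : topcoord (u * val t)%g (part_map (z t')) =
    \sum_(u' | left_part t' u')
      if (u * val t == u' * val t')%g then partcoord u' (z t') : M else 0.
  rewrite part_map_sum pE; apply: eq_bigr => u' Du'.
  exact: topcoord_basis dm (left_part_rmin Du').
transitivity (\sum_(t' : rep) \sum_(u' | left_part t' u')
    if (u * val t == u' * val t')%g then partcoord u' (z t') : M else 0).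
  by rewrite pE; apply: eq_bigr => t' _; apply: expand.
rewrite (bigD1 t isT) (bigD1 u Du) /= eqxx big1 => [|u' /andP[_ nu]];
  last first.
  by case: eqP => // /mulIg E; case/eqP: nu.
rewrite addr0 big1 ?addr0 // => t' nt; rewrite big1 // => u' Du'.
case: eqP => // E; have /andP[uJ um] := Du; have /andP[uJ' um'] := Du'.
have [tt' _] := rmin_dcoset_inj cS sJS sIS (valP t) (valP t') uJ uJ' um um' E.
by case/eqP: nt; apply: val_inj.
Qed.

Definition mackey_inv (y : indM) : dsum (fun t : rep => part t) := fun t =>
  \sum_(u | left_part t u) tens (inclJ t) (to_par J (hpi u)) (topcoord (u *
    val t)%g y : resM t).

Lemma mackey_mapK : cancel mackey_map mackey_inv.
Proof.
move=> z; apply: boolp.functional_extensionality_dep => t.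
by rewrite [RHS]partcoord_sum; apply: eq_bigr => u Du; rewrite topcoord_mackey.
Qed.

Lemma mackey_invK : cancel mackey_inv mackey_map.
Proof.
move=> y; rewrite [LHS]topcoord_sum [RHS]topcoord_sum; apply: eq_bigr => d dm.
have [t0 [u [tr uJ um ->]]] := rmin_dcoset_ex cS sJS sIS dm.
pose t : rep := exist _ t0 tr.
have Du : left_part t u by rewrite /left_part uJ.
congr tens; rewrite -[t0]/(val t) topcoord_mackey //.
rewrite /mackey_inv (zmod_morphism_sum (partcoord_zmod Du)) (bigD1 u) //=.
rewrite partcoord_basis // eqxx big1 ?addr0 //.
by move=> u' /andP[Du' nu]; rewrite partcoord_basis // eq_sym (negPf nu).
Qed.

Lemma mackey_inv_linear : linear (mackey_inv : twist (val : HK J -> H) indM ->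
  _).
Proof.
move=> x y y'; apply: (can_inj mackey_mapK).
by rewrite mackey_map_linear !mackey_invK.
Qed.

Lemma mackey_iso :
  lmod_iso (twist (val : HK J -> H) indM) (dsum (fun t : rep => part t)).
Proof.
exact: (lmod_isoI (U := twist (val : HK J -> H) indM) mackey_inv_linear
  mackey_invK mackey_mapK).
Qed.
End Mackey.

Theorem theorem3p4 (R : comPzRingType) (a b : R)
    (W : finGroupType) (S : {set W}) (I J : {set W})
    (cS : coxeter_system S) (sIS : I \subset S) (sJS : J \subset S)
    (M : lmodType (hecke_par a b S I)) :
  exists c : forall t : {w : W | w \in min_dcoset_reps S J I},
      {rmorphism hecke_par a b S (dcosetK J I (val t))
         -> hecke_par a b S (dcosetK J I (val t) :^ val t)%g},
    (forall t (r : R) x, c t (r *: x)%R = (r *: c t x)%R) /\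
    (forall t k (kK : k \in dcosetK J I (val t)),
       val (c t (pgen a b S kK)) = hgen a b S (k ^ val t)%g) /\
    lmod_iso
      (twist (val : hecke_par a b S J -> hecke a b S)
         (induced (val : hecke_par a b S I -> hecke a b S) M))
      (dsum (fun t : {w : W | w \in min_dcoset_reps S J I} =>
         induced (par_incl (dcosetK_subl J I (val t)))
           (twist (c t)
              (twist (par_incl (dcosetK_conj_sub J I (val t))) M)))).
Proof.
exists (dcoset_twist a b cS sJS sIS); split; last split.
- exact: dcoset_twistZ.
- exact: dcoset_twist_gen.
- exact: (mackey_iso cS sJS sIS M).
Qed.
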